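(* Let $n\ge2$ and let $\lambda=(\lambda_1,\dots,\lambda_n)$ be a $\mathfrak{gl}_n$-weight. In each of the following cases, $\lambda$ is a $\sigma$-relation weight for all $\sigma\in S_n$: (i) $\lambda_i-\lambda_j\notin\mathbb Z$ for all $1\le i<j\le n$; (ii) $\lambda_i-\lambda_j\in\mathbb Z_{\ge0}$ for all $1\le i<j\le n$.
   Context: A $\mathfrak{gl}_n$-weight is a tuple $\lambda=(\lambda_1,\dots,\lambda_n)\in\mathbb C^n$ ($\lambda_i$ is the value on the matrix unit $E_{ii}$); $\bar\lambda=\lambda+(0,-1,\dots,-n+1)$. **Graphs $G_\sigma$.** Let $\mathfrak V=\{(i,j): 1\le j\le i\le n\}$; $(k,1),\dots,(k,k)$ form row $k$, row $n$ being the top row. $\Sigma$ is the set of directed graphs on $\mathfrak V$ having, for each $1\le s<r\le n$, exactly one of the arrows $(r,s)\to(r-1,s)$ (then $A_{(r,s)}(G)=1$) or $(r-1,s)\to(r,s)$ (then $A_{(r,s)}(G)=-1$), and no other arrows. Let $\alpha_{ij}=\varepsilon_i-\varepsilon_j$ ($i\ne j$), $\Delta^+=\{\alpha_{ij}: i<j\}$, $\sigma(\alpha_{ij})=\alpha_{\sigma(i)\sigma(j)}$, and for $G\in\Sigma$ put $\mathcal Q_G=\{\alpha_{ij}: i<j, A_{(j,i)}(G)=1\}\cup\{\alpha_{ji}: i<j, A_{(j,i)}(G)=-1\}$. $G_\sigma$ is the unique element of $\Sigma$ with $\mathcal Q_{G_\sigma}=\sigma(\Delta^+)$. **Tableaux.**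 A Gelfand-Tsetlin tableau $T(L)$ is a triangular array of complex numbers $l_{ij}$ indexed by $(i,j)\in\mathfrak V$. For $X\in\mathbb C^n$, $T_\sigma(X)=T(Y)$ is defined by $y_{n,i}=x_{\sigma^{-1}(i)}$ and, recursively for $k=n,\dots,2$ and $1\le i\le k-1$, $y_{k-1,i}=y_{k,i}$ if $G_\sigma$ has an arrow $(k,i)\to(k-1,i)$, and $y_{k-1,i}=y_{k,i}+1$ if $G_\sigma$ has an arrow $(k-1,i)\to(k,i)$. **Relation graphs.** All graphs are directed graphs on $\mathfrak V$ whose arrows connect only vertices in consecutive rows or vertices of row $n$, without oriented cycles or multiple arrows. $G$ is non-critical if any two vertices in the same row $k<n$ lying in the same connected component of the underlying unoriented graph are joined by an oriented path from one to the other. $T(L)$ satisfies $G$ if for each arrow $(i,j)\to(r,s)$ one has $l_{ij}-l_{rs}\in\mathbb Z_{\ge0}$ when the arrow is horizontal or points down ($r=i-1$), and $l_{ij}-l_{rs}\in\mathbb Z_{>0}$ when it points up ($r=i+1$). $T(L)$ is a $G$-realization if it satisfies $G$ and, for all $1\le k\le n-1$, $l_{ki}-l_{kj}\in\mathbb Z$ only if $(k,i),(k,j)$ are in the same connected component. For a $G$-realization $T(L)$, $V_G(T(L))$ is the complex vector space with basis all $G$-realizations $T(L+z)$, $z$ an integer array with $z_{ni}=0$ for all $i$. A non-critical $G$ is a relation graph if for every $G$-realization $T(L)$ the Gelfand-Tsetlin formulas $$E_{k,k+1}T(L)=-\sum_{i=1}^k\frac{\prod_{j=1}^{k+1}(l_{ki}-l_{k+1,j})}{\prod_{j\ne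 i}(l_{ki}-l_{kj})}T(L+\delta^{ki}),\quad E_{k+1,k}T(L)=\sum_{i=1}^k\frac{\prod_{j=1}^{k-1}(l_{ki}-l_{k-1,j})}{\prod_{j\ne i}(l_{ki}-l_{kj})}T(L-\delta^{ki}),$$ $$E_{kk}T(L)=\Big(k-1+\sum_{i=1}^kl_{ki}-\sum_{i=1}^{k-1}l_{k-1,i}\Big)T(L)$$ define a $\mathfrak{gl}_n$-module structure on $V_G(T(L))$; here $T(L\pm\delta^{ki})$ is $T(L)$ with $\pm1$ added to entry $(k,i)$, and a summand is $0$ by definition if the new tableau is not a $G$-realization. **Graph of a tableau.** $G(T(L))$ is the transitive reduction (same reachability, minimal set of arrows) of the graph on $\mathfrak V$ with an arrow $(i,j)\to(r,s)$ if: (i) $i=r+1$ and $l_{ij}-l_{rs}\in\mathbb Z_{\ge0}$; or (ii) $i=r-1$ and $l_{ij}-l_{rs}\in\mathbb Z_{>0}$; or (iii) $i=r=n$, $j\neq s$, and $l_{nj}-l_{ns}\in\mathbb Z_{\ge0}$, where if $l_{nj}=l_{ns}$ only the arrow from the smaller to the larger index is taken. **$\sigma$-relation weight.** $\lambda$ is a $\sigma$-relation weight if $G(T_\sigma(\bar\lambda))$ is a relation graph. *)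

(* Defs.v *)
From HB Require Import structures.
From mathcomp Require Import all_boot all_order all_fingroup all_algebra.
From mathcomp Require Import boolp.
From mathcomp Require Import complex reals.
From mathcomp Require Import monalg.

Set Implicit Arguments.
Unset Strict Implicit.
Unset Printing Implicit Defensive.
Import Order.TTheory GRing.Theory Num.Theory.
Local Open Scope ring_scope.

(* Row and column indices are 0-based throughout: row k and column i here are
   row k + 1 and column i + 1 of the usual notation, so that the top row (row n)
   is the one with (vrow v).+1 = n. *)

Definition is_int (C : numFieldType) (x : C) : Prop := exists m : int, x = m%:~R.
Definition is_nneg (C : numFieldType) (x : C) : Prop := exists m : nat, x = m%:R.
Definition is_pos (C : numFieldType) (x : C) : Prop :=
  exists m : nat, x = m.+1%:R.

Definition vertex (n : nat) := {p : 'I_n * 'I_n | (p.2 <= p.1)%N}.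
Definition vrow (n : nat) (v : vertex n) : 'I_n := (val v).1.
Definition vcol (n : nat) (v : vertex n) : 'I_n := (val v).2.
Definition vtop (n : nat) (v : vertex n) : bool := (vrow v).+1 == n.

(* The arrow u -> v is the pair (u, v). *)
Definition graph (n : nat) := {set vertex n * vertex n}.
Definition arrow (n : nat) (G : graph n) : rel (vertex n) :=
  fun u v => (u, v) \in G.
Definition reach (n : nat) (G : graph n) : rel (vertex n) := connect (arrow G).
Definition same_component (n : nat) (G : graph n) : rel (vertex n) :=
  connect (fun u v => arrow G u v || arrow G v u).

Section Sigma.
Variable n : nat.
Implicit Types (G : graph n) (u v w : vertex n) (s : 'S_n).

Definition above v w : bool := (vrow v == (vrow w).+1 :> nat) && (vcol v == vcol w).

Definition in_Sigma G : bool :=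
  [forall v, forall w, above v w ==> (arrow G v w (+) arrow G w v)] &&
  [forall v, forall w, arrow G v w ==> above v w || above w v].

(* arrow_sign G v is A_(r,s)(G) for v = (r,s); it is 0 when s = r. *)
Definition arrow_sign G v : int :=
  if [exists w, above v w && arrow G v w] then 1
  else if [exists w, above v w && arrow G w v] then -1 else 0.

(* The root eps_i - eps_j is encoded by the pair (i, j). *)
Definition QG G : {set 'I_n * 'I_n} :=
  [set (vcol v, vrow v) | v : vertex n & (vcol v < vrow v)%N && (arrow_sign G v == 1)] :|:
  [set (vrow v, vcol v) | v : vertex n & (vcol v < vrow v)%N && (arrow_sign G v == -1)].

Definition positive_roots : {set 'I_n * 'I_n} :=
  [set p : 'I_n * 'I_n | (p.1 < p.2)%N].
Definition act_roots s (D : {set 'I_n * 'I_n}) : {set 'I_n * 'I_n} :=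
  [set (s p.1, s p.2) | p in D].

Definition is_Gsigma s G : bool :=
  in_Sigma G && (QG G == act_roots s positive_roots).

(* The default value is never used: existence and uniqueness are GsigmaP and
   Gsigma_uniq below. *)
Definition Gsigma s : graph n := odflt set0 [pick G | is_Gsigma s G].

End Sigma.

Section Tableaux.
Variables (C : numFieldType) (n : nat).
Implicit Types (G : graph n) (u v w : vertex n) (s : 'S_n).

Definition tableau := {ffun vertex n -> C}.
Implicit Types (L S : tableau).

(* Tsigma_entry s X d i is the entry in column i, d rows below the top row; the
   defining recursion is Tsigma_top and Tsigma_rec below. *)
Fixpoint Tsigma_entry s (X : 'I_n -> C) (d : nat) (i : 'I_n) : C :=
  if d is d'.+1 then
    if [exists v, exists w, [&& above v w, (vrow v + d'.+1)%N == n, vcol v == i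
                              & arrow (Gsigma s) w v]]
    then Tsigma_entry s X d' i + 1 else Tsigma_entry s X d' i
  else X ((s^-1)%g i).

Definition Tsigma s (X : 'I_n -> C) : tableau :=
  [ffun v => Tsigma_entry s X (n - (vrow v).+1) (vcol v)].

Definition shifted_weight (lam : 'I_n -> C) : 'I_n -> C :=
  fun i => lam i - (i : nat)%:R.

Definition admissible G : Prop :=
  (forall u v, arrow G u v ->
     [\/ vrow u = (vrow v).+1 :> nat, vrow v = (vrow u).+1 :> nat | vtop u /\ vtop v])
  /\ (forall u v, arrow G u v -> ~~ reach G v u).

Definition noncritical G : Prop :=
  forall u v, vrow u = vrow v -> ~~ vtop u -> same_component G u v ->
    reach G u v || reach G v u.

Definition satisfies G L : Prop :=
  forall u v, arrow G u v ->
    if vrow v == (vrow u).+1 :> nat then is_pos (L u - L v) else is_nneg (L u - L v).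

Definition realization G L : Prop :=
  satisfies G L /\
  (forall u v, vrow u = vrow v -> ~~ vtop u -> is_int (L u - L v) ->
     same_component G u v).

Definition integral_shift L S : Prop :=
  exists z : vertex n -> int,
    (forall v, vtop v -> z v = 0) /\ S = [ffun v => L v + (z v)%:~R].

Definition basisVG G L :=
  {S : tableau | `[< realization G S /\ integral_shift L S >]}.

(* {malg C[B]} is the free C-vector space on the set B, with basis << b >>. *)
Definition VG G L := {malg C[basisVG G L]}.

(* The vector T(S), or 0 when T(S) is not a G-realization. *)
Definition vecT G L S : VG G L :=
  if insub S is Some b then << b >> else 0.

Definition add_delta (v : vertex n) (c : C) S : tableau :=
  [ffun w => S w + (if w == v then c else 0)].

Definition denom S v : C :=
  \prod_(w | (vrow w == vrow v) && (w != v)) (S v - S w).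

Definition GT_raise G L (k : 'I_n) S : VG G L :=
  - \sum_(v | vrow v == k)
      ((\prod_(w | vrow w == k.+1 :> nat) (S v - S w)) / denom S v)
        *: vecT G L (add_delta v 1 S).

Definition GT_lower G L (k : 'I_n) S : VG G L :=
  \sum_(v | vrow v == k)
      ((\prod_(w | (vrow w).+1 == k :> nat) (S v - S w)) / denom S v)
        *: vecT G L (add_delta v (-1) S).

Definition GT_diag G L (k : 'I_n) S : VG G L :=
  ((k : nat)%:R + \sum_(v | vrow v == k) S v - \sum_(v | (vrow v).+1 == k :> nat) S v)
    *: vecT G L S.

Definition gl_module (V : lmodType C) (rho : 'M[C]_n -> V -> V) : Prop :=
  [/\ forall A, linear (rho A),
      forall x, linear (rho^~ x)
    & forall A B x, rho (A *m B - B *m A) x = rho A (rho B x) - rho B (rho A x)].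

Definition GT_module G L : Prop :=
  exists rho : 'M[C]_n -> VG G L -> VG G L,
    [/\ gl_module rho,
        forall (k l : 'I_n) (b : basisVG G L), l = k.+1 :> nat ->
          rho (delta_mx k l) << b >> = GT_raise G L k (val b),
        forall (k l : 'I_n) (b : basisVG G L), l = k.+1 :> nat ->
          rho (delta_mx l k) << b >> = GT_lower G L k (val b)
      & forall (k : 'I_n) (b : basisVG G L),
          rho (delta_mx k k) << b >> = GT_diag G L k (val b)].

Definition relation_graph G : Prop :=
  [/\ admissible G, noncritical G
    & forall L, realization G L -> GT_module G L].

Definition pre_graph L : graph n :=
  [set e : vertex n * vertex n |
    let u := e.1 in let v := e.2 in
    [|| (vrow u == (vrow v).+1 :> nat) && `[< is_nneg (L u - L v) >],
        (vrow v == (vrow u).+1 :> nat) && `[< is_pos (L u - L v) >]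
      | [&& vtop u, vtop v, u != v, `[< is_nneg (L u - L v) >]
          & (L u == L v) ==> (vcol u < vcol v)%N]]].

Definition same_reach G (H : graph n) : bool :=
  [forall u, forall v, reach H u v == reach G u v].

(* For an acyclic G, such as pre_graph L, this is the only minimal graph with the
   same reachability, see transitive_reduction_uniq below. *)
Definition transitive_reduction G : graph n :=
  [arg min_(H < G | same_reach G H) #|H|]%N.

Definition graph_of L : graph n := transitive_reduction (pre_graph L).

Definition sigma_relation_weight s (lam : 'I_n -> C) : Prop :=
  relation_graph (graph_of (Tsigma s (shifted_weight lam))).

End Tableaux.

Section SigmaFacts.
Variable n : nat.
Implicit Types (G : graph n) (u v w : vertex n) (s : 'S_n).

Lemma vertex_eq u v : vrow u = vrow v -> vcol u = vcol v -> u = v.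
Proof.
rewrite /vrow /vcol => e1 e2; apply: val_inj.
by rewrite [val u]surjective_pairing [val v]surjective_pairing e1 e2.
Qed.

Lemma above_vcol_lt v w : above v w -> (vcol v < vrow v)%N.
Proof. by case/andP=> /eqP -> /eqP ->; rewrite ltnS (valP w). Qed.

Lemma above_inj v w w' : above v w -> above v w' -> w = w'.
Proof.
case/andP=> /eqP e1 /eqP e2 /andP[/eqP e3 /eqP e4].
by apply: vertex_eq; [apply: val_inj; case: (eq_trans (esym e1) e3) | rewrite -e2].
Qed.

Lemma above_asym v w : above v w -> above w v = false.
Proof.
case/andP=> /eqP e1 _; apply/negP => /andP[/eqP e2 _]; move: e1.
by rewrite e2 => /eqP; rewrite eqn_leq ltnNge leqnSn andbF.
Qed.

Lemma ex_above v : (vcol v < vrow v)%N -> exists w, above v w.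
Proof.
move=> lt; have r0 : (0 < vrow v)%N by apply: leq_ltn_trans lt.
have hr : ((vrow v).-1 < n)%N by rewrite (leq_ltn_trans (leq_pred _)).
have h : ((Ordinal hr, vcol v).2 <= (Ordinal hr, vcol v).1)%N by rewrite /= -ltnS prednK.
exists (exist _ (Ordinal hr, vcol v) h).
by rewrite /above /vrow /vcol /= prednK ?eqxx.
Qed.

Lemma arrow_signE G v w : above v w ->
  arrow_sign G v = if arrow G v w then 1 else if arrow G w v then -1 else 0.
Proof.
move=> vw; rewrite /arrow_sign.
have e P : [exists w', above v w' && P w'] = P w.
  apply/existsP/idP => [[w' /andP[vw' Pw']]|Pw]; last by exists w; rewrite vw.
  by rewrite (above_inj vw vw').
by rewrite (e (arrow G v)) (e (arrow G^~ v)).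
Qed.

Lemma in_SigmaP G : reflect
  ((forall v w, above v w -> arrow G v w (+) arrow G w v) /\
   (forall v w, arrow G v w -> above v w || above w v)) (in_Sigma G).
Proof.
apply: (iffP andP) => -[h1 h2]; split.
- by move=> v w; move/forallP: h1 => /(_ v) /forallP /(_ w) /implyP.
- by move=> v w; move/forallP: h2 => /(_ v) /forallP /(_ w) /implyP.
- by apply/forallP => v; apply/forallP => w; apply/implyP; apply: h1.
- by apply/forallP => v; apply/forallP => w; apply/implyP; apply: h2.
Qed.

Lemma mem_QG G v w : in_Sigma G -> above v w ->
  (((vcol v, vrow v) \in QG G) = arrow G v w) *
  (((vrow v, vcol v) \in QG G) = arrow G w v).
Proof.
move=> /in_SigmaP[h _] vw; have lt := above_vcol_lt vw; have hx := h _ _ vw.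
have e := arrow_signE G vw.
have sub u (b : int) (uv : vcol u = vcol v /\ vrow u = vrow v) :
  arrow_sign G u = b -> arrow_sign G v = b.
  by case: uv => e1 e2; rewrite (vertex_eq e2 e1).
split; rewrite inE; apply/idP/idP.
- case/orP => /imsetP[u]; rewrite inE => /andP[lu /eqP su] [e1 e2].
  + by move: (sub u _ (conj (esym e1) (esym e2)) su); rewrite e; do 2 case: (arrow G _ _).
  + by move: lu; rewrite -e1 -e2 ltnNge ltnW.
- by move=> a; apply/orP; left; apply/imsetP; exists v; rewrite // inE lt e a.
- case/orP => /imsetP[u]; rewrite inE => /andP[lu /eqP su] [e1 e2].
  + by move: lu; rewrite -e1 -e2 ltnNge ltnW.
  + by move: (sub u _ (conj (esym e2) (esym e1)) su); rewrite e; do 2 case: (arrow G _ _).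
- move=> a; apply/orP; right; apply/imsetP; exists v; rewrite // inE lt e.
  by move: hx; rewrite a; case: (arrow G v w).
Qed.

Lemma mem_act_roots s i j :
  ((i, j) \in act_roots s (positive_roots n)) = ((s^-1)%g i < (s^-1)%g j)%N.
Proof.
apply/imsetP/idP => [[[a b]]|lt]; first by rewrite inE /= => ab [-> ->]; rewrite !permK.
by exists ((s^-1)%g i, (s^-1)%g j); rewrite ?inE //= !permKV.
Qed.

Lemma Gsigma_exists s : exists G, is_Gsigma s G.
Proof.
pose D := act_roots s (positive_roots n).
pose G : graph n := [set e | above e.1 e.2 && ((vcol e.1, vrow e.1) \in D)
                          || above e.2 e.1 && ((vrow e.2, vcol e.2) \in D)].
have Gd v w : above v w -> arrow G v w = ((vcol v, vrow v) \in D).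
  by move=> vw; rewrite /arrow inE /= vw (above_asym vw) orbF.
have Gu v w : above v w -> arrow G w v = ((vrow v, vcol v) \in D).
  by move=> vw; rewrite /arrow inE /= vw (above_asym vw).
have GS : in_Sigma G.
  apply/in_SigmaP; split=> v w.
    move=> vw; rewrite Gd // Gu // !mem_act_roots.
    case: ltngtP => // e; have := above_vcol_lt vw.
    by rewrite (perm_inj (val_inj e)) ltnn.
  by rewrite /arrow inE /= => /orP[] /andP[-> _]; rewrite ?orbT.
exists G; rewrite /is_Gsigma GS /=; apply/eqP/setP => -[i j].
case: (ltngtP i j) => ij.
- have h : ((j, i).2 <= (j, i).1)%N by rewrite /= ltnW.
  have [|w vw] := @ex_above (exist _ (j, i) h); first exact: ij.
  by have [+ _] := mem_QG GS vw; rewrite Gd //= => ->.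
- have h : ((i, j).2 <= (i, j).1)%N by rewrite /= ltnW.
  have [|w vw] := @ex_above (exist _ (i, j) h); first exact: ij.
  by have [_ +] := mem_QG GS vw; rewrite Gu //= => ->.
- rewrite (val_inj ij) mem_act_roots ltnn; apply/negP; rewrite inE.
  by case/orP => /imsetP[u]; rewrite inE => /andP[lu _] [e1 e2]; 
    move: lu; rewrite -e1 -e2 ltnn.
Qed.

Lemma GsigmaP s : is_Gsigma s (Gsigma s).
Proof.
rewrite /Gsigma; case: pickP => //= h.
by have [G] := Gsigma_exists s; rewrite h.
Qed.

Lemma Gsigma_uniq s G : is_Gsigma s G -> G = Gsigma s.
Proof.
move=> /andP[GS /eqP GQ]; have /andP[HS /eqP HQ] := GsigmaP s.
have E v w : above v w ->
    arrow G v w = arrow (Gsigma s) v w /\ arrow G w v = arrow (Gsigma s) w v.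
  move=> vw; have [<- <-] := mem_QG GS vw; have [<- <-] := mem_QG HS vw.
  by rewrite GQ HQ.
apply/setP => -[u v]; rewrite -!/(arrow _ u v).
have [/in_SigmaP[_ gG] /in_SigmaP[_ gH]] := (GS, HS).
by apply/idP/idP => a; [have := gG _ _ a | have := gH _ _ a];
  case/orP => /E[e1 e2]; move: a; rewrite ?e1 ?e2.
Qed.

End SigmaFacts.

Section TableauFacts.
Variables (C : numFieldType) (n : nat).
Implicit Types (G H : graph n) (u v w : vertex n) (s : 'S_n) (X : 'I_n -> C).

Lemma Tsigma_top s X v : vtop v -> Tsigma s X v = X ((s^-1)%g (vcol v)).
Proof. by move=> /eqP t; rewrite ffunE t subnn. Qed.

Lemma Tsigma_rec s X v w : above v w ->
  Tsigma s X w = if arrow (Gsigma s) w v then Tsigma s X v + 1 else Tsigma s X v.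
Proof.
move=> vw; have /andP[/eqP e1 /eqP e2] := vw; rewrite !ffunE.
have ltv : ((vrow v).+1 <= n)%N by exact: ltn_ord.
have -> : (n - (vrow w).+1 = (n - (vrow v).+1).+1)%N by rewrite -e1 -subSn.
rewrite /= -e2; congr (if _ then _ else _).
apply/existsP/idP => [[v' /existsP[w' /and4P[vw' /eqP h /eqP e a]]]|a].
  have ev : v' = v.
    apply: vertex_eq => //; apply: val_inj; apply: succn_inj => /=.
    apply/eqP; rewrite -(eqn_add2r (n - (vrow v).+1)) addSnnS h subnKC //.
  by rewrite ev in vw' a; rewrite (above_inj vw vw').
exists v; apply/existsP; exists w; rewrite vw a eqxx !andbT /=.
by rewrite -addSnnS subnKC.
Qed.

Lemma pre_graph_acyclic (L : tableau C n) u v :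
  arrow (pre_graph L) u v -> ~~ reach (pre_graph L) v u.
Proof.
set P := pre_graph L.
pose rk (x : vertex n) := (vrow x * n + (n - vcol x))%N.
have step x y : arrow P x y -> L y < L x \/ (L y = L x /\ (rk y < rk x)%N).
  rewrite /arrow inE /= => /or3P[].
  - case/andP=> /eqP e /asboolP[m hm]; case: m hm => [|m] hm; last first.
      by left; rewrite -subr_gt0 hm ltr0n.
    right; split; first by apply/esym/eqP; rewrite -subr_eq0 hm.
    rewrite /rk e mulSnr -addnA ltn_add2l.
    by rewrite (leq_ltn_trans (leq_subr _ _)) // -{1}[n]addn0 ltn_add2l subn_gt0.
  - by case/andP=> _ /asboolP[m hm]; left; rewrite -subr_gt0 hm ltr0n.
  - case/and5P=> /eqP tx /eqP ty _ /asboolP[m hm] tie.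
    case: m hm => [|m] hm; last by left; rewrite -subr_gt0 hm ltr0n.
    have e : L x = L y by apply/eqP; rewrite -subr_eq0 hm.
    right; split=> //; move: tie; rewrite e eqxx /= => lt.
    have exy : vrow x = vrow y by apply: val_inj; apply: succn_inj; rewrite /= tx ty.
    by rewrite /rk exy ltn_add2l ltn_sub2l.
have far x y : reach P x y -> L y < L x \/ (L y = L x /\ (rk y <= rk x)%N).
  case/connectP=> p; elim: p x => [|z p IH] x /=; first by move=> _ ->; right.
  case/andP=> /step xz /IH h /h{h} zy.
  case: xz zy => [lt|[-> lt]] [lt'|[-> lt']]; [left|left|left|right] => //.
    exact: lt_trans lt' lt.
  by split=> //; apply: leq_trans lt' (ltnW lt).
move=> /step uv; apply/negP => /far vu.
case: uv vu => [lt|[e lt]] [lt'|[e' lt']].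
- by move: (lt_trans lt lt'); rewrite ltxx.
- by move: lt; rewrite e' ltxx.
- by move: lt'; rewrite e ltxx.
- by move: (leq_ltn_trans lt' lt); rewrite ltnn.
Qed.

Lemma same_reachP G H : reflect (reach H =2 reach G) (same_reach G H).
Proof.
apply: (iffP forallP) => [h u v | h u]; first by move/forallP: (h u) => /(_ v) /eqP.
by apply/forallP => v; rewrite h.
Qed.

Lemma transitive_reductionP G :
  reach (transitive_reduction G) =2 reach G /\
  (forall H, reach H =2 reach G -> (#|transitive_reduction G| <= #|H|)%N).
Proof.
rewrite /transitive_reduction; case: arg_minnP => [|H /same_reachP h m].
  exact/same_reachP.
by split=> // H' /same_reachP; apply: m.
Qed.

(* For acyclic G, the arrows of the reduction are the covering pairs, so every
   inclusion-minimal graph with the same reachability is the same graph. *)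
Lemma transitive_reduction_uniq G H :
  (forall u v, arrow G u v -> ~~ reach G v u) ->
  reach H =2 reach G ->
  (forall H', H' \subset H -> reach H' =2 reach G -> H' = H) ->
  H = transitive_reduction G.
Proof.
move=> acG.
have anti u v : reach G u v -> reach G v u -> u = v.
  case/connectP=> -[|w p] /=; first by move=> _ ->.
  case/andP=> uw pth e vu; have := acG _ _ uw.
  rewrite (_ : reach G w u) //; apply: connect_trans vu.
  by apply/connectP; exists p.
pose cov u v := [&& u != v, reach G u v &
  [forall w, reach G u w && reach G w v ==> (w == u) || (w == v)]].
pose K : graph n := [set e | cov e.1 e.2].
have covsub H' : reach H' =2 reach G -> K \subset H'.
  move=> eH; apply/subsetP => -[u v]; rewrite inE /= => /and3P[uv + /forallP hall].
  rewrite -eH => /connectP[p]; elim: p => [|w p IH] /=.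
    by move=> _ e; rewrite e eqxx in uv.
  case/andP=> uw pth e; have := hall w.
  have -> : reach G u w by rewrite -eH; apply: connect1.
  have -> /= : reach G w v by rewrite -eH; apply/connectP; exists p.
  by case/orP=> /eqP ew; [rewrite ew in pth e; apply: IH | rewrite -ew].
have KG u v : reach K u v -> reach G u v.
  case/connectP=> p; elim: p u => [|w p IH] u /=; first by move=> _ ->; apply: connect0.
  rewrite {1}/arrow inE => /andP[/and3P[_ uw _] pth] e.
  by apply: connect_trans uw _; apply: IH.
have GK u v : reach G u v -> reach K u v.
  pose I u v := [set w | reach G u w && reach G w v].
  have [m] := ubnP #|I u v|; elim: m u v => // m IH u v; rewrite ltnS => Im uv.
  have [->|nuv] := eqVneq u v; first exact: connect0.
  case: (boolP (cov u v)) => [c|]; first by apply: connect1; rewrite /arrow inE.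
  rewrite /cov nuv uv /= negb_forall => /existsP[w].
  rewrite negb_imply negb_or => /andP[/andP[uw wv] /andP[wu wv']].
  apply: (@connect_trans _ _ w); apply: IH => //; apply: leq_trans Im; apply: proper_card.
    apply/properP; split.
      apply/subsetP => x; rewrite !inE => /andP[-> xw] /=; exact: connect_trans xw wv.
    exists v; rewrite !inE uv ?[reach G v v]connect0 //=.
    by apply/negP => vw; rewrite (anti _ _ wv vw) eqxx in wv'.
  apply/properP; split.
    apply/subsetP => x; rewrite !inE => /andP[wx ->]; rewrite andbT.
    exact: connect_trans uw wx.
  exists u; rewrite !inE uv ?[reach G u u]connect0 // andbT.
  by apply/negP => wu'; rewrite (anti _ _ uw wu') eqxx in wu.
have KE : reach K =2 reach G by move=> u v; apply/idP/idP; [apply: KG | apply: GK].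
move=> eH minH; rewrite -(minH K (covsub _ eH) KE).
have [eR minR] := transitive_reductionP G.
by apply/eqP; rewrite eqEcard (covsub _ eR) (minR _ KE).
Qed.

End TableauFacts.

(* Main.v *)
(** A graph of a tableau is a relation graph once its realizations keep distinct
    entries in every row below the top one and any two entries differing by [1]
    have an entry of each neighbouring row squeezed between them by arrows.
    Indeed, the coefficient of a move that leaves the set of realizations through
    a downward arrow vanishes, and so does that of a move that re-enters it
    through an upward arrow; a product of coefficients along a path between two
    realizations is therefore not affected by dropping the tableaux that are not
    realizations.  The Serre relations become rational identities between such
    products, whose only possible singularities (entries of one row that differ
    by [1]) are excluded by the squeezed entry in the row that does not move, and
    [E_k F_k - F_k E_k = H_k - H_{k+1}] is the residue theorem for a rational
    function whose double poles are cancelled by the same squeezed entries.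

    For a generic weight all arrows stay inside columns.  For a dominant weight,
    sorting each row of [T_sigma] gives the highest weight tableau, so the graph
    is the Hasse diagram of the product order on (rank, row - rank). *)
Require Import Defs.
From HB Require Import structures.
From mathcomp Require Import all_boot all_order all_fingroup all_algebra.
From mathcomp Require Import complex reals.
From mathcomp Require Import finmap boolp functions monalg ring zify.

Set Implicit Arguments.
Unset Strict Implicit.
Unset Printing Implicit Defensive.
Import Order.TTheory GRing.Theory Num.Theory.
Local Open Scope ring_scope.

(** * Serre presentation *)

Section SerrePresentation.
Variables (T : zmodType) (N : nat).
Implicit Types (br : T -> T -> T) (e f h : nat -> T).

(** Additivity is asked on the left only: antisymmetry carries it to the right. The Jacobi identity
    is in the form that makes [br x] a derivation. The alternating law [br x x = 0] follows once
    there is no 2-torsion, the later hypothesis [no2]. *)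
Definition lie_bracket br : Prop :=
  [/\ forall x y z, br (x + y) z = br x z + br y z,
      forall x y, br x y = - br y x
    & forall x y z, br x (br y z) = br (br x y) z + br y (br x z)].

(** Reversing the bracket turns the relations of the lowering generators into those of the raising
    ones, so each computation with [e] also serves for [f]. The booleans are Kronecker deltas. *)
Definition half_serre br e h : Prop :=
  [/\ forall k l, (k < N)%N -> (l.+1 < N)%N ->
        br (h k) (e l) = e l *+ (k == l) - e l *+ (k == l.+1),
      forall k l, (k.+1 < l)%N -> (l.+1 < N)%N -> br (e k) (e l) = 0,
      forall k, (k.+2 < N)%N -> br (br (e k) (e k.+1)) (e k) = 0
    & forall k, (k.+2 < N)%N -> br (br (e k) (e k.+1)) (e k.+1) = 0].

Definition flip_bracket br : T -> T -> T := fun x y => br y x.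

Definition serre_relations br e f h : Prop :=
  [/\ half_serre br e h, half_serre (flip_bracket br) f h,
      forall k l, (k.+1 < N)%N -> (l.+1 < N)%N ->
        br (e k) (f l) = (h k - h k.+1) *+ (k == l)
    & forall k l, (k < N)%N -> (l < N)%N -> br (h k) (h l) = 0].

Lemma lie_bracket_flip br : lie_bracket br -> lie_bracket (flip_bracket br).
Proof.
case=> D A J; rewrite /flip_bracket; split.
- by move=> x y z; rewrite A D opprD -!A.
- by move=> x y; rewrite A.
- by move=> x y z; rewrite [br z (br y x)]J -addrA [br y _]A addNr addr0.
Qed.

Lemma serre_relations_flip br e f h :
  serre_relations br e f h -> serre_relations (flip_bracket br) f e h.
Proof.
case=> He Hf Hef Hh; split=> //.
  move=> k l Hk Hl; rewrite /flip_bracket Hef // eq_sym.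
  by case: eqP => // ->.
by move=> k l Hk Hl; apply: Hh.
Qed.

(** The left-normed bracket [[[e_i, e_(i+1)], ..., e_(j-1)]], meaningful for [i < j]. *)
Fixpoint root_vector br e (i j : nat) : T :=
  if j is j'.+1 then
    if i == j' then e i else br (root_vector br e i j') (e j')
  else 0.

Definition matrix_unit br e f h (i j : nat) : T :=
  if (i < j)%N then root_vector br e i j
  else if (j < i)%N then root_vector (flip_bracket br) f j i else h i.

Lemma matrix_unit_flip br e f h i j :
  matrix_unit (flip_bracket br) f e h i j = matrix_unit br e f h j i.
Proof.
by rewrite /matrix_unit; case: ltngtP => // ->.
Qed.

(** * Brackets of root vectors with the generators *)

Section Relations.
Variables (br : T -> T -> T) (e f h : nat -> T).
Hypotheses (no2 : forall x : T, x + x = 0 -> x = 0).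
Hypotheses (lie : lie_bracket br) (serre : serre_relations br e f h).

Let D x y z : br (x + y) z = br x z + br y z. Proof. by case: lie. Qed.
Let A x y : br x y = - br y x. Proof. by case: lie. Qed.
Let J x y z : br x (br y z) = br (br x y) z + br y (br x z).
Proof. by case: lie. Qed.
Let Dr x y z : br x (y + z) = br x y + br x z.
Proof. by rewrite A D opprD -!A. Qed.
Let b0l x : br 0 x = 0.
Proof. by apply: (addrI (br 0 x)); rewrite -D !addr0. Qed.
Let b0r x : br x 0 = 0. Proof. by rewrite A b0l oppr0. Qed.
Let Nl x y : br (- x) y = - br x y.
Proof. by apply: (addrI (br x y)); rewrite -D !subrr b0l. Qed.
Let Nr x y : br x (- y) = - br x y.
Proof. by rewrite A Nl -A. Qed.
Let xx x : br x x = 0.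
Proof. by apply: no2; rewrite {1}A addNr. Qed.
Let mull x y m : br (x *+ m) y = br x y *+ m.
Proof. by elim: m => [|m IH]; rewrite ?mulr0n ?b0l // !mulrS D IH. Qed.
Let mulr x y m : br x (y *+ m) = br x y *+ m.
Proof. by rewrite A mull -mulNrn -A. Qed.
(* The Jacobi identity as the Leibniz rule of the right bracket. *)
Let Jr x y z : br (br x y) z = br (br x z) y + br x (br y z).
Proof. by rewrite [br x (br y z)]J addrCA [br y _]A subrr addr0. Qed.

Let U := root_vector br e.
Let E := matrix_unit br e f h.

Let he k l : (k < N)%N -> (l.+1 < N)%N ->
  br (h k) (e l) = e l *+ (k == l) - e l *+ (k == l.+1).
Proof. by case: serre => -[H _ _ _] _ _ _; apply: H. Qed.
Let ef k l : (k.+1 < N)%N -> (l.+1 < N)%N ->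
  br (e k) (f l) = (h k - h k.+1) *+ (k == l).
Proof. by case: serre => _ _ H _; apply: H. Qed.
Let hh k l : (k < N)%N -> (l < N)%N -> br (h k) (h l) = 0.
Proof. by case: serre => _ _ _ H; apply: H. Qed.
Let ee k l : (k.+1 < l)%N -> (l.+1 < N)%N -> br (e k) (e l) = 0.
Proof. by case: serre => -[_ H _ _] _ _ _; apply: H. Qed.
Let s1 k : (k.+2 < N)%N -> br (br (e k) (e k.+1)) (e k) = 0.
Proof. by case: serre => -[_ _ H _] _ _ _; apply: H. Qed.
Let s2 k : (k.+2 < N)%N -> br (br (e k) (e k.+1)) (e k.+1) = 0.
Proof. by case: serre => -[_ _ _ H] _ _ _; apply: H. Qed.
Let ee' k l : (l.+1 < k)%N -> (k.+1 < N)%N -> br (e k) (e l) = 0.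
Proof. by move=> h1 h2; rewrite A ee // oppr0. Qed.

Let U1 i : U i i.+1 = e i. Proof. by rewrite /U /= eqxx. Qed.
Let US i j : (i < j)%N -> U i j.+1 = br (U i j) (e j).
Proof. by rewrite /U /= => lt; case: eqP => // eij; rewrite eij ltnn in lt. Qed.

Let EU i j : (i < j)%N -> E i j = U i j.
Proof. by rewrite /E /matrix_unit => ->. Qed.
Let Ed i : E i i = h i. Proof. by rewrite /E /matrix_unit ltnn. Qed.

Let U_far i j k : (i < j)%N -> (j < N)%N -> (k.+1 < N)%N ->
  (k.+1 < i)%N || (j < k)%N -> br (U i j) (e k) = 0.
Proof.
elim: j => // j IH; rewrite ltnS leq_eqVlt => /orP[/eqP <-|ij] jN kN far.
  by rewrite U1; case/orP: far => hk; [apply: ee'|apply: ee].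
by rewrite US // Jr IH ?b0l ?add0r; [|lia..]; case/orP: far => hk;
  [rewrite ee' ?b0r //; lia|rewrite ee ?b0r //; lia].
Qed.

(** Chains are built on the right; as [e k] commutes with the distant generators appended there, the
    Jacobi identity lets them grow on the left as well. *)
Let U_left k j : (k.+1 < j)%N -> (j < N)%N -> br (e k) (U k.+1 j) = U k j.
Proof.
elim: j => // j IH; rewrite ltnS leq_eqVlt => /orP[/eqP <-|kj] jN.
  by rewrite U1 US ?U1.
by rewrite !US //; [rewrite J IH ?ee ?b0r ?addr0 //; lia | lia].
Qed.

(** Let [b], [c] be the last two generators of the chain and [a] the part before them. As [a]
    commutes with [c], the chain is [[a, [b, c]]], and bracketing with [c] only leaves the Serre
    term [[[b, c], c] = 0]. *)
Let U_end i k : (i < k)%N -> (k.+1 < N)%N -> br (U i k.+1) (e k) = 0.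
Proof.
case: k => // k; rewrite ltnS leq_eqVlt => /orP[/eqP <-|ik] kN.
  by rewrite US // U1 s2.
have Uk : br (U i k) (e k.+1) = 0 by apply: U_far; lia.
rewrite US; last lia; rewrite (US ik).
have -> : br (br (U i k) (e k)) (e k.+1) = br (U i k) (br (e k) (e k.+1)).
  by rewrite Jr Uk b0l add0r.
by rewrite Jr Uk b0l add0r s2 // b0r.
Qed.

Let U_start i j : (i < j)%N -> (j < N)%N -> br (U i j) (e i) = 0.
Proof.
elim: j => // j IH; rewrite ltnS leq_eqVlt => /orP[/eqP <-|ij] jN.
  by rewrite U1 xx.
rewrite US //; move: ij; rewrite leq_eqVlt => /orP[/eqP eij|ij].
  by rewrite -eij U1 s1 //; lia.
by rewrite Jr IH ?b0l ?add0r ?ee' ?b0r //; lia.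
Qed.

(* Expanding [[[A, b], c], b] along either bracketing of [[A, b], c] gives two
   opposite values, so it vanishes. *)
Let U_mid i j k : (i < k)%N -> (k.+1 < j)%N -> (j < N)%N -> br (U i j) (e k) = 0.
Proof.
elim: j => // j IH ik; rewrite ltnS leq_eqVlt => /orP[/eqP <-|kj] jN; last first.
  by rewrite US; [rewrite Jr IH ?b0l ?add0r ?ee' ?b0r //; lia|lia].
rewrite !US; [|lia..]; set a := U i k.
have ac : br a (e k.+1) = 0 by apply: U_far; lia.
have abb : br (br a (e k)) (e k) = 0 by rewrite -US // U_end //; lia.
have bcb : br (br (e k) (e k.+1)) (e k) = 0 by apply: s1.
have x1 : br (br (br a (e k)) (e k.+1)) (e k) = br (br a (e k)) (br (e k.+1) (e k)).
  by rewrite Jr abb b0l add0r.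
have x2 : br (br (br a (e k)) (e k.+1)) (e k) = br (br a (e k)) (br (e k) (e k.+1)).
  by rewrite [br (br a _) (e k.+1)]Jr ac b0l add0r Jr bcb b0r addr0.
by apply: no2; rewrite {1}x1 x2 -Dr [br (e k.+1) _]A addNr b0r.
Qed.

(** The generator [e k] prolongs the chain at its right or at its left end; in every other position
    of [k] one of the vanishing statements above applies. *)
Lemma root_vector_raise i j k : (i < j)%N -> (j < N)%N -> (k.+1 < N)%N ->
  br (E i j) (e k) = E i k.+1 *+ (j == k) - E k j *+ (i == k.+1).
Proof.
move=> ij jN kN; rewrite EU //.
have [ejk|jk] := eqVneq j k.
  subst j; rewrite EU ?US //; last lia.
  by rewrite mulr1n (_ : (i == k.+1) = false) ?subr0 //; lia.
have [eik|ik] := eqVneq i k.+1.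
  by subst i; rewrite A U_left ?mulr0n ?sub0r ?EU //; lia.
rewrite !mulr0n subr0.
have [c|c] := boolP ((k.+1 < i)%N || (j < k)%N); first exact: U_far.
have [->|c1] := eqVneq k i; first exact: U_start.
have [c2|c2] := eqVneq j k.+1; first by subst j; apply: U_end => //; lia.
by apply: U_mid; lia.
Qed.

Lemma root_vector_diag i j k : (i < j)%N -> (j < N)%N -> (k < N)%N ->
  br (E i j) (h k) = E i j *+ (j == k) - E i j *+ (i == k).
Proof.
move=> + + kN; elim: j => // j IH; rewrite ltnS leq_eqVlt => /orP[/eqP <-|ij] jN.
  by rewrite EU // U1 A he // opprB [_ == k]eq_sym [i == k]eq_sym.
rewrite EU ?US //; last lia.
rewrite Jr -EU // IH //; last lia.
rewrite D Nl !mull [br (e j) _]A he //; rewrite opprB Dr Nr !mulr.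
by rewrite !(eq_sym k) addrC addrA subrK.
Qed.

(** The last generator is peeled off by the Leibniz rule. Shortening the chain at its right end
    comes from [[e j, f j] = h j - h j.+1], shortening it at its left end from the induction
    hypothesis. *)
Lemma root_vector_lower i j k : (i < j)%N -> (j < N)%N -> (k.+1 < N)%N ->
  br (E i j) (f k) = E i k *+ (j == k.+1) - E k.+1 j *+ (i == k).
Proof.
move=> + + kN; elim: j => // j IH; rewrite ltnS leq_eqVlt => /orP[/eqP <-|ij] jN.
  rewrite EU // U1 ef // eqSS; case: eqP => [<-|]; last by rewrite !mulr0n subrr.
  by rewrite !mulr1n !Ed.
have -> : E i j.+1 = br (E i j) (e j) by rewrite !EU ?US //; lia.
rewrite Jr IH // ?ef //; last lia.
rewrite D Nl !mull mulr Dr Nr !root_vector_diag //; try lia.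
have -> : br (E i k) (e j) *+ (j == k.+1) = 0.
  case: eqP => // ejk; rewrite mulr1n; have [eik|ik] := eqVneq i k.
    by subst i; rewrite Ed he; [|lia..]; do 2 (case: eqP; first lia); rewrite subrr.
  rewrite root_vector_raise //; [|lia..].
  by case: eqP; [lia|case: eqP; [lia|rewrite subrr]].
have -> : br (E k.+1 j) (e j) *+ (i == k) = E k.+1 j.+1 *+ (i == k).
  case: eqP => // eik; subst i; rewrite !mulr1n.
  have [ejk|jk] := eqVneq j k.+1.
    subst j; rewrite Ed he; [|lia..]; rewrite EU // U1 eqxx mulr1n.
    by case: eqP; [lia|rewrite subr0].
  rewrite root_vector_raise ?eqxx; [|lia..].
  by case: eqP; [lia|rewrite subr0].
rewrite eqSS sub0r addrC; congr (_ - _).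
have [ejk|//] := eqVneq j k; subst k; rewrite !mulr1n !eqxx.
by do 3 (case: eqP; try lia); move=> *; rewrite ?subr0.
Qed.

End Relations.

Theorem matrix_unit_bracket br e f h :
  (forall x : T, x + x = 0 -> x = 0) ->
  lie_bracket br -> serre_relations br e f h ->
  let E := matrix_unit br e f h in
  forall i j k l, (i < N)%N -> (j < N)%N -> (k < N)%N -> (l < N)%N ->
    br (E i j) (E k l) = E i l *+ (j == k) - E k j *+ (i == l).
Proof.
move=> no2 lie serre E; have [D A J] := lie.
have lie' := lie_bracket_flip lie; have serre' := serre_relations_flip serre.
have [[he _ _ _] [hf _ _ _] ef hh] := serre; rewrite /flip_bracket in hf.
have Dr x y z : br x (y + z) = br x y + br x z by rewrite A D opprD -!A.
have b0l x : br 0 x = 0 by apply: (addrI (br 0 x)); rewrite -D !addr0.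
have b0r x : br x 0 = 0 by rewrite A b0l oppr0.
have Nl x y : br (- x) y = - br x y.
  by apply: (addrI (br x y)); rewrite -D !subrr b0l.
have Nr x y : br x (- y) = - br x y by rewrite A Nl -A.
have ml x y (m : bool) : br (x *+ m) y = br x y *+ m.
  by case: m; rewrite ?mulr0n ?b0l.
have mr x y (m : bool) : br x (y *+ m) = br x y *+ m.
  by case: m; rewrite ?mulr0n ?b0r.
have Ed i : E i i = h i by rewrite /E /matrix_unit ltnn.
have Ee i : E i i.+1 = e i by rewrite /E /matrix_unit ltnSn /= eqxx.
have Ef i : E i.+1 i = f i by rewrite /E -matrix_unit_flip /matrix_unit ltnSn /= eqxx.
have flipE i j : matrix_unit (flip_bracket br) f e h i j = E j i.
  exact: matrix_unit_flip.
(* The bracket formula for [E k l] against all matrix units. It is checked on the generators and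
   transported by [compat_trans]: the Jacobi identity determines the bracket with [E k m =
   [E k l, E l m]], and moving one index at a time reaches every pair. *)
pose compat k l := forall i j, (i < N)%N -> (j < N)%N ->
  br (E i j) (E k l) = E i l *+ (j == k) - E k j *+ (i == l).
have compat_h k : (k < N)%N -> compat k k.
  move=> kN i j iN jN; rewrite Ed; have [ij|ji|<-] := ltngtP i j.
  - rewrite (root_vector_diag lie serre) //.
    by case: eqP => [->|_]; case: eqP => [->|_].
  (* Below the diagonal, the reversed bracket with [e] and [f] exchanged brings the case back to the
     one above it. *)
  - have := root_vector_diag lie' serre' ji iN kN.
    rewrite !flipE {1}/flip_bracket => hE; rewrite A hE opprB.
    by case: eqP => [->|_]; case: eqP => [->|_].
  - by rewrite Ed hh //; case: eqP => [<-|_]; rewrite subrr.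
have compat_e k : (k.+1 < N)%N -> compat k k.+1.
  move=> kN i j iN jN; rewrite Ee; have [ij|ji|<-] := ltngtP i j.
  - exact: (root_vector_raise no2 lie serre).
  - have := root_vector_lower no2 lie' serre' ji iN kN.
    by rewrite !flipE {1}/flip_bracket => hE; rewrite A hE opprB.
  - rewrite Ed he //; case: eqP => [->|_]; first by rewrite Ee; case: eqP => [|_]; [lia|].
    by case: eqP => [->|//]; rewrite Ee.
have compat_f k : (k.+1 < N)%N -> compat k.+1 k.
  move=> kN i j iN jN; rewrite Ef; have [ij|ji|<-] := ltngtP i j.
  - exact: (root_vector_lower no2 lie serre).
  - have := root_vector_raise no2 lie' serre' ji iN kN.
    by rewrite !flipE {1}/flip_bracket => hE; rewrite A hE opprB.
  - rewrite Ed A hf // opprB.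
    case: eqP => [->|_]; first by rewrite Ef; case: eqP => [|_]; [lia|].
    by case: eqP => [->|//]; rewrite Ef.
have compat_trans k l m : (k < N)%N -> (l < N)%N -> (m < N)%N -> k != m ->
    compat k l -> compat l m -> compat k m.
  move=> kN lN mN km ckl clm i j iN jN.
  have -> : E k m = br (E k l) (E l m).
    by rewrite clm // eqxx (negbTE km) subr0.
  have kl i' m' : (i' < N)%N -> (m' < N)%N ->
    br (E k l) (E i' m') = E k m' *+ (i' == l) - E i' l *+ (m' == k).
    by move=> *; rewrite A ckl // opprB.
  rewrite J ckl // D Nl !ml !clm //.
  rewrite Dr Nr !mr !kl // !eqxx (negbTE km) [m == k]eq_sym (negbTE km).
  rewrite !mulr0n !mulr1n !subr0.
  by case: (j == k); case: (i == l); case: (j == l); case: (i == m);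
    rewrite ?mulr1n ?mulr0n ?subr0 ?sub0r ?addr0 ?add0r ?oppr0 ?opprB ?addrA
      ?addNr ?add0r ?subrr ?subrK ?sub0r.
have compat_all k l : (k < N)%N -> (l < N)%N -> compat k l.
  move=> kN lN; have [kl|lk|<-] := ltngtP k l; last exact: compat_h.
    elim: l lN kl => // l IH lN; rewrite ltnS leq_eqVlt => /orP[/eqP ekl|kl].
      by subst l; apply: compat_e.
    apply: (compat_trans k l l.+1) => //; try lia; last exact: compat_e.
    by apply: IH => //; lia.
  elim: k kN lk => // k IH kN; rewrite ltnS leq_eqVlt => /orP[/eqP elk|lk].
    by subst k; apply: compat_f.
  apply: (compat_trans k.+1 k l) => //; try lia; first exact: compat_f.
  by apply: IH => //; lia.
by move=> i j k l iN jN kN lN; apply: compat_all.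
Qed.

End SerrePresentation.

(** * Lagrange interpolation *)

Section Lagrange.
Variable F : fieldType.
Implicit Types (A B : seq F) (b c : F).

(** For distinct entries of [B], the sum of the finite residues of
    [\prod_A (X - a) / \prod_B (X - b)]. At a repeated [b] the product over [rem b B] is zero, so
    the term is [0]. *)
Definition residue_sum A B : F :=
  \sum_(b <- B) (\prod_(a <- A) (b - a)) / \prod_(c <- rem b B) (b - c).

Lemma residue_sum_perm A A' B B' :
  perm_eq A A' -> perm_eq B B' -> residue_sum A B = residue_sum A' B'.
Proof.
move=> AA BB; rewrite /residue_sum (perm_big _ BB) /=; apply: eq_big_seq => b bB.
rewrite (perm_big _ AA); congr (_ / _); apply: perm_big.
by rewrite -(perm_cons b) -(permPl (perm_to_rem _)) ?(perm_mem BB) //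
  -(permPr (perm_to_rem bB)).
Qed.

Lemma residue_sum_uniq A B : uniq B -> size A = size B ->
  residue_sum A B = \sum_(b <- B) b - \sum_(a <- A) a.
Proof.
move=> uB sAB; have [/size0nil B0|B_gt0] := posnP (size B).
  by move: sAB; rewrite B0 => /size0nil ->; rewrite /residue_sum !big_nil subr0.
pose P s : {poly F} := \prod_(a <- s) ('X - a%:P).
pose cf b := (\prod_(a <- A) (b - a)) / \prod_(c <- rem b B) (b - c).
pose I := \sum_(b <- B) cf b *: P (rem b B).
have szP s : size (P s) = (size s).+1 by rewrite size_prod_XsubC.
have hP s x : (P s).[x] = \prod_(a <- s) (x - a).
  by rewrite horner_prod; apply: eq_bigr => a _; rewrite hornerXsubC.
have srem b : b \in B -> size (rem b B) = (size B).-1 by move=> bB; rewrite size_rem.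
have sub_top s : s != [::] -> (P s)`_(size s).-1 = - \sum_(x <- s) x.
  by move=> s0; apply: coefPn_prod_XsubC; rewrite size_eq0.
have lead1 s : (P s)`_(size s) = 1.
  have := monic_prod_XsubC s predT id.
  by rewrite monicE /lead_coef -/(P s) szP => /eqP.
(* The monic polynomials [P A] and [P B] have equal degree, so [P A - P B] has smaller degree and is
   its own Lagrange interpolant [I] at the roots [B]. The result is the comparison of the
   coefficients of degree [(size B).-1]. *)
have interp : P A - P B - I = 0.
  apply: (@roots_geq_poly_eq0 _ _ B) => //; last first.
    apply/leq_sizeP => j jB; rewrite coefB [I`_j]coef_sum.
    rewrite [X in _ - X]big_seq [X in _ - X]big1 ?subr0; last first.
      by move=> b bB; rewrite coefZ nth_default ?mulr0 // szP srem // prednK.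
    move: jB; rewrite leq_eqVlt => /orP[/eqP <- |jB].
      by rewrite coefB -{1}sAB !lead1 subrr.
    by rewrite coefB !nth_default ?subr0 // szP // sAB.
  apply/allP => x xB; rewrite rootE !hornerD !hornerN !hP horner_sum.
  rewrite (big_rem _ xB) /= subrr mul0r subr0 (big_rem _ xB) /= hornerZ hP.
  rewrite [X in _ - (_ + X)]big_seq [X in _ - (_ + X)]big1 ?addr0; last first.
    move=> b; rewrite (mem_rem_uniq _ uB) inE => /andP[bx bB].
    rewrite hornerZ hP (big_rem x) /= ?subrr ?mul0r ?mulr0 //.
    by rewrite (mem_rem_uniq _ uB) inE eq_sym bx.
  rewrite /cf divfK ?subrr // prodf_seq_neq0; apply/allP => c.
  by rewrite (mem_rem_uniq _ uB) inE => /andP[cx _] /=; rewrite subr_eq0 eq_sym.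
have := congr1 (fun p : {poly F} => p`_(size B).-1) interp.
rewrite !coefB coef0 coef_sum /residue_sum => /eqP; rewrite subr_eq0 => /eqP.
rewrite -{1}sAB !sub_top -?size_eq0 ?sAB -?lt0n // opprK addrC => ->.
by apply: eq_big_seq => b bB; rewrite coefZ -(srem b bB) lead1 mulr1.
Qed.

(** The factor [X - b] cancels from every term except one at another copy of [b] in [B]; there a
    second copy of [b] in [A] makes both sides vanish. *)
Lemma residue_sum_cancel A B b : (b \notin B) || (b \in A) ->
  residue_sum (b :: A) (b :: B) = residue_sum A B.
Proof.
move=> hb; rewrite /residue_sum big_cons big_cons subrr mul0r mul0r add0r.
apply: eq_big_seq => c cB; rewrite big_cons /= eq_sym.
have [ebc|nbc] := eqVneq c b.
  subst c; rewrite subrr !mul0r; rewrite cB /= in hb.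
  by rewrite (big_rem _ hb) /= subrr !mul0r.
by rewrite big_cons -mulf_div divff ?mul1r // subr_eq0.
Qed.

(* Multiple poles are allowed as long as the numerator cancels all of them: the
   junk value [x / 0 = 0] is then harmless. *)
Lemma residue_sumE A B : size A = size B ->
  (forall b, (1 < count_mem b B)%N -> (count_mem b B <= count_mem b A)%N) ->
  residue_sum A B = \sum_(b <- B) b - \sum_(a <- A) a.
Proof.
have [m] := ubnP (size B); elim: m A B => // m IH A B; rewrite ltnS => sB sAB cnt.
have [uB|] := boolP (uniq B); first exact: residue_sum_uniq.
move=> nuB; have [b cb] : exists b, (1 < count_mem b B)%N.
  apply: contrapT => h; case/negP: nuB; apply: count_mem_uniq => x.
  have := h; rewrite -has_pred1 has_count.
  by case: (count_mem x B) (fun H => h (ex_intro _ x H)) => [|[|c]] // /(_ isT).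
have cab := cnt b cb.
have bB : b \in B by rewrite -has_pred1 has_count; lia.
have bA : b \in A by rewrite -has_pred1 has_count; lia.
have pB := perm_to_rem bB; have pA := perm_to_rem bA.
rewrite (residue_sum_perm pA pB) (perm_big _ pA) (perm_big _ pB) /= !big_cons.
have cntA x : count_mem x A = ((b == x) + count_mem x (rem b A))%N.
  by rewrite (seq.permP pA).
have cntB x : count_mem x B = ((b == x) + count_mem x (rem b B))%N.
  by rewrite (seq.permP pB).
rewrite residue_sum_cancel; last first.
  by rewrite orbC -has_pred1 has_count; have := cntA b; rewrite eqxx; lia.
rewrite IH; first by rewrite opprD addrACA subrr add0r.
- by rewrite size_rem //; case: (B) bB sB => //= ? ? _; lia.
- by rewrite !size_rem // sAB.
- by move=> x; move: (cnt x); rewrite cntA cntB; case: (b == x) => /=; lia.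
Qed.
End Lagrange.

(** * Endomorphisms of free modules *)

Section FreeModuleEndomorphisms.
Variables (C : numFieldType) (K : choiceType).
Local Notation V := {malg C[K]}.
Implicit Types (g : K -> V) (x y : V) (k : K).

Fact lin_ext_key : unit. Proof. by []. Qed.
(** Endomorphisms are handled through their values on the basis: the functions [K -> V] form an
    additive group with extensional equality, on which the abstract bracket computations apply. The
    lock keeps the sum from being unfolded. *)
Definition lin_ext : (K -> V) -> V -> V :=
  locked_with lin_ext_key (fun g x => \sum_(k <- msupp x) x@_k *: g k).

Lemma lin_extE g x : lin_ext g x = \sum_(k <- msupp x) x@_k *: g k.
Proof. by rewrite /lin_ext unlock. Qed.

Lemma lin_extEw g x (d : {fset K}) : (msupp x `<=` d)%fset ->
  lin_ext g x = \sum_(k <- d) x@_k *: g k.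
Proof.
move=> sub; rewrite lin_extE; apply: big_fset_incl => // k _ kx.
by rewrite mcoeff_outdom // scale0r.
Qed.

Lemma lin_ext_linear g : linear (lin_ext g).
Proof.
move=> a x y; pose d := (msupp x `|` msupp y)%fset.
rewrite (@lin_extEw g (a *: x + y) d).
  rewrite (@lin_extEw g x d) ?fsubsetUl // (@lin_extEw g y d) ?fsubsetUr //.
  rewrite scaler_sumr -big_split /=; apply: eq_bigr => k _.
  by rewrite mcoeffD mcoeffZ scalerDl scalerA.
apply: fsubset_trans (msuppD_le _ _) _; apply: fsetSU; exact: msuppZ_le.
Qed.

HB.instance Definition _ g :=
  GRing.isLinear.Build C V V *:%R (lin_ext g) (lin_ext_linear g).

Lemma lin_extU g k : lin_ext g << k >> = g k.
Proof. by rewrite lin_extE msuppU oner_eq0 big_seq_fset1 mcoeffUU scale1r. Qed.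

Lemma malg_linear_eq (f1 f2 : {linear V -> V}) :
  (forall k, f1 << k >> = f2 << k >>) -> f1 =1 f2.
Proof.
move=> eqf x; rewrite (monalgE x) !linear_sum; apply: eq_bigr => k _.
have -> : << x@_k *g k >> = x@_k *: << k >> :> V.
  by apply/malgP => l; rewrite mcoeffZ !mcoeffU mulrnAr mulr1.
by rewrite !linearZ /= eqf.
Qed.

Lemma lin_ext_sub g x y : lin_ext g (x - y) = lin_ext g x - lin_ext g y.
Proof. exact: linearB. Qed.

Lemma lin_extZ g a x : lin_ext g (a *: x) = a *: lin_ext g x.
Proof. exact: linearZZ. Qed.

Lemma lin_ext_sum g (I : Type) (r : seq I) (P : pred I) (F : I -> V) :
  lin_ext g (\sum_(i <- r | P i) F i) = \sum_(i <- r | P i) lin_ext g (F i).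
Proof. exact: linear_sum. Qed.

Lemma lin_extD g1 g2 x : lin_ext (g1 + g2) x = lin_ext g1 x + lin_ext g2 x.
Proof. by rewrite !lin_extE -big_split; apply: eq_bigr => k _; rewrite scalerDr. Qed.

Lemma lin_extN g x : lin_ext (- g) x = - lin_ext g x.
Proof. by rewrite !lin_extE -sumrN; apply: eq_bigr => k _; rewrite scalerN. Qed.

Lemma lin_extMn g x m : lin_ext (g *+ m) x = lin_ext g x *+ m.
Proof.
elim: m => [|m IH]; first by rewrite !mulr0n lin_extE big1 // => k _; rewrite scaler0.
by rewrite !mulrS lin_extD IH.
Qed.

Definition end_bracket g1 g2 : K -> V := fun k => lin_ext g1 (g2 k) - lin_ext g2 (g1 k).

Lemma lin_ext_bracket g1 g2 x :
  lin_ext (end_bracket g1 g2) x = lin_ext g1 (lin_ext g2 x) - lin_ext g2 (lin_ext g1 x).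
Proof.
pose f := (lin_ext g1 \o lin_ext g2) \- (lin_ext g2 \o lin_ext g1).
rewrite -[RHS]/(f x); apply: (malg_linear_eq (f1 := lin_ext _) (f2 := f)) => k.
by rewrite /f /= !lin_extU.
Qed.

Lemma end_bracketE g1 g2 k :
  end_bracket g1 g2 k = lin_ext g1 (g2 k) - lin_ext g2 (g1 k).
Proof. by []. Qed.

Lemma end_bracket_lie : lie_bracket end_bracket.
Proof.
split=> [x y z|x y|x y z]; apply/funext => k.
- by rewrite addrfctE !end_bracketE lin_extD addrfctE linearD /= opprD addrACA.
- by rewrite opprfctE !end_bracketE opprB.
- rewrite addrfctE end_bracketE lin_ext_bracket !end_bracketE.
  rewrite !lin_ext_bracket !lin_ext_sub.
  move: (lin_ext x (lin_ext y (z k))) (lin_ext x (lin_ext z (y k))) => a b.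
  move: (lin_ext y (lin_ext z (x k))) (lin_ext y (lin_ext x (z k))) => c p.
  move: (lin_ext z (lin_ext y (x k))) (lin_ext z (lin_ext x (y k))) => q d.
  by rewrite !opprB [RHS]addrACA !subrKA addrACA [- b + _]addrC addrACA.
Qed.

End FreeModuleEndomorphisms.

(** * From the Serre relations to a $\mathfrak{gl}_n$-module *)

Section ModuleOfSerreRelations.
Variables (C : numFieldType) (K : choiceType) (n : nat).
Local Notation V := {malg C[K]}.

Theorem gl_module_of_serre (e f h : nat -> K -> V) :
  serre_relations n (@end_bracket C K) e f h ->
  exists rho : 'M[C]_n -> V -> V,
    [/\ gl_module rho,
        forall (k l : 'I_n) b, l = k.+1 :> nat -> rho (delta_mx k l) << b >> = e k b,
        forall (k l : 'I_n) b, l = k.+1 :> nat -> rho (delta_mx l k) << b >> = f k b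
      & forall (k : 'I_n) b, rho (delta_mx k k) << b >> = h k b].
Proof.
move=> serre; pose E i j := matrix_unit (@end_bracket C K) e f h i j.
have no2 (g : K -> V) : g + g = 0 -> g = 0.
  move=> gg; apply/funext => k; have := congr1 (fun u => u k) gg.
  rewrite fctE -mulr2n -scaler_nat => /eqP.
  by rewrite scaler_eq0 pnatr_eq0 /= => /eqP.
have EE (i j k l : 'I_n) x :
    lin_ext (E i j) (lin_ext (E k l) x) - lin_ext (E k l) (lin_ext (E i j) x) =
    lin_ext (E i l) x *+ (j == k) - lin_ext (E k j) x *+ (i == l).
  rewrite -lin_ext_bracket (matrix_unit_bracket no2 (@end_bracket_lie C K) serre) //.
  by rewrite lin_extD lin_extN !lin_extMn.
pose rho (A : 'M[C]_n) (x : V) := \sum_i \sum_j A i j *: lin_ext (E i j) x.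
have rhoE (k l : 'I_n) x : rho (delta_mx k l) x = lin_ext (E k l) x.
  rewrite /rho (bigD1 k) //= (bigD1 l) //= mxE !eqxx scale1r !big1 ?addr0 //.
    by move=> i ik; rewrite big1 // => j _; rewrite mxE (negbTE ik) scale0r.
  by move=> j jl; rewrite mxE (negbTE jl) andbF scale0r.
have rho_linl A : linear (rho A).
  move=> a x y; rewrite scaler_sumr -big_split; apply: eq_bigr => i _ /=.
  rewrite scaler_sumr -big_split; apply: eq_bigr => j _ /=.
  by rewrite linearP scalerDr !scalerA mulrC.
exists rho; split; last first.
- by move=> k b; rewrite rhoE lin_extU /E /matrix_unit ltnn.
- move=> k l b kl; rewrite rhoE lin_extU /E /matrix_unit kl ltnNge leqnSn /=.
  by rewrite ltnSn eqxx.
- by move=> k l b kl; rewrite rhoE lin_extU /E /matrix_unit kl ltnSn /= eqxx.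
split=> // [x|A B x].
  move=> a A B; rewrite scaler_sumr -big_split; apply: eq_bigr => i _ /=.
  rewrite scaler_sumr -big_split; apply: eq_bigr => j _ /=.
  by rewrite !mxE scalerDl scalerA.
(* Both composites become fourfold sums over matrix units; [EE] leaves only the terms with [j = k]
   or [i = l], and these assemble to the entries of [A *m B] and [B *m A]. *)
have rr A' B' : rho A' (rho B' x) =
    \sum_i \sum_j \sum_k \sum_l
      (A' i j * B' k l) *: lin_ext (E i j) (lin_ext (E k l) x).
  rewrite {1}/rho; apply: eq_bigr => i _; apply: eq_bigr => j _.
  rewrite /rho (linear_sum (lin_ext (E i j))) scaler_sumr; apply: eq_bigr => k _.
  rewrite (linear_sum (lin_ext (E i j))) scaler_sumr; apply: eq_bigr => l _.
  by rewrite (linearZZ (lin_ext (E i j))) scalerA.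
have pairs (F : 'I_n -> 'I_n -> 'I_n -> 'I_n -> V) :
    \sum_i \sum_j \sum_k \sum_l F i j k l =
    \sum_(p : 'I_n * 'I_n) \sum_(q : 'I_n * 'I_n) F p.1 p.2 q.1 q.2.
  by rewrite pair_bigA; apply: eq_bigr => p _; rewrite pair_bigA.
have swap : rho B (rho A x) = \sum_i \sum_j \sum_k \sum_l
    (A i j * B k l) *: lin_ext (E k l) (lin_ext (E i j) x).
  rewrite rr !pairs exchange_big; apply: eq_bigr => p _; apply: eq_bigr => q _.
  by rewrite mulrC.
rewrite swap rr -sumrB.
transitivity (\sum_i \sum_j \sum_k \sum_l ((A i j * B k l) *:
    (lin_ext (E i l) x *+ (j == k)) - (A i j * B k l) *:
    (lin_ext (E k j) x *+ (i == l)))); last first.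
  apply: eq_bigr => i _; rewrite -sumrB; apply: eq_bigr => j _.
  rewrite -sumrB; apply: eq_bigr => k _; rewrite -sumrB; apply: eq_bigr => l _.
  by rewrite -!scalerBr EE.
have -> : rho (A *m B - B *m A) x = rho (A *m B) x - rho (B *m A) x.
  rewrite -sumrB; apply: eq_bigr => i _; rewrite -sumrB; apply: eq_bigr => j _.
  by rewrite !mxE scalerBl.
under [RHS]eq_bigr do under eq_bigr do under eq_bigr do rewrite sumrB.
under [RHS]eq_bigr do under eq_bigr do rewrite sumrB.
under [RHS]eq_bigr do rewrite sumrB.
rewrite sumrB; congr (_ - _).
  apply: eq_bigr => i _; under [RHS]eq_bigr do rewrite exchange_big /=.
  rewrite [RHS]exchange_big /=; apply: eq_bigr => l _.
  rewrite mxE scaler_suml; apply: eq_bigr => j _.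
  rewrite (bigD1 j) //= eqxx mulr1n big1 ?addr0 // => k kj.
  by rewrite eq_sym (negbTE kj) mulr0n scaler0.
under [RHS]eq_bigr do rewrite exchange_big /=.
rewrite [RHS]exchange_big /=; apply: eq_bigr => k _.
rewrite [RHS]exchange_big /=; apply: eq_bigr => j _.
rewrite mxE scaler_suml; apply: eq_bigr => i _.
rewrite (bigD1 i) //= eqxx mulr1n [A i j * _]mulrC big1 ?addr0 // => l li.
by rewrite eq_sym (negbTE li) mulr0n scaler0.
Qed.
End ModuleOfSerreRelations.

(** * Gelfand-Tsetlin coefficients *)

Definition adjacent_arrows (n : nat) (G : graph n) : Prop :=
  forall u v, arrow G u v ->
    [\/ vrow u = (vrow v).+1 :> nat, vrow v = (vrow u).+1 :> nat | vtop u /\ vtop v].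

Definition separated (C : numFieldType) (n : nat) (G : graph n) : Prop :=
  forall S : tableau C n, realization G S -> forall v w,
    vrow v = vrow w -> ~~ vtop v -> v != w ->
    S v <> S w /\
    (S v = S w + 1 -> exists u t,
      [/\ (vrow u).+1 = vrow v :> nat, vrow t = (vrow v).+1 :> nat,
          arrow G v u /\ arrow G u w & arrow G v t /\ arrow G t w]).

Section GelfandTsetlin.
Variables (C : numFieldType) (n : nat) (G : graph n) (L : tableau C n).
Implicit Types (u v w x y t : vertex n) (S : tableau C n) (b c : bool) (a : C)
  (P : pred (vertex n)).

Definition sg b : C := if b then 1 else -1.
Definition step b v S : tableau C n := add_delta v (sg b) S.

(* The row entering the numerator of the coefficient: the one above for raising
   moves, the one below for lowering moves. *)
Definition ref_row b v t : bool :=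
  if b then vrow t == (vrow v).+1 :> nat else (vrow t).+1 == vrow v :> nat.

Definition diffs (P : pred (vertex n)) S v : C := \prod_(t | P t) (S v - S t).
(** One formula for both directions: [- sg b] is the sign in front of the raising formula and is [1]
    for lowering. *)
Definition coef b v S : C := - sg b * diffs (ref_row b v) S v / denom S v.

Definition good S : bool := `[< realization G S /\ integral_shift L S >].

Lemma add_eq v a S : add_delta v a S v = S v + a.
Proof. by rewrite ffunE eqxx. Qed.

Lemma add_neq v a S x : x != v -> add_delta v a S x = S x.
Proof. by rewrite ffunE => /negbTE ->; rewrite addr0. Qed.

Lemma add_deltaC v w a a' S :
  add_delta v a (add_delta w a' S) = add_delta w a' (add_delta v a S).
Proof. by apply/ffunP => x; rewrite !ffunE addrAC. Qed.

Lemma stepC b c v w S : step b v (step c w S) = step c w (step b v S).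
Proof. exact: add_deltaC. Qed.

Lemma add_deltaD v a a' S : add_delta v a (add_delta v a' S) = add_delta v (a' + a) S.
Proof.
by apply/ffunP => x; rewrite !ffunE -addrA; case: eqP; rewrite ?addr0.
Qed.

Lemma add_delta0 v S : add_delta v 0 S = S.
Proof. by apply/ffunP => x; rewrite ffunE; case: eqP; rewrite addr0. Qed.

Lemma diffs_add P x a S v : x != v -> ~~ P x ->
  diffs P (add_delta x a S) v = diffs P S v.
Proof.
move=> xv Px; apply: eq_bigr => t Pt; rewrite add_neq 1?eq_sym // add_neq //.
by apply: contraNneq Px => <-.
Qed.

Lemma diffsD1 P S v x : P x ->
  diffs P S v = (S v - S x) * diffs (fun t => P t && (t != x)) S v.
Proof. by move=> Px; rewrite /diffs (bigD1 x). Qed.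

Definition row_mates v w : bool := (vrow w == vrow v) && (w != v).

Lemma denomE S v : denom S v = diffs (row_mates v) S v.
Proof. by []. Qed.

Lemma ref_row_neq b v t : ref_row b v t -> vrow t != vrow v.
Proof. by rewrite /ref_row -val_eqE /=; case: b => /eqP h; apply/eqP; lia. Qed.

Lemma ref_row_notin b v t : vrow t = vrow v -> ~~ ref_row b v t.
Proof. by move=> e; apply/negP => /ref_row_neq; rewrite e eqxx. Qed.

Lemma ref_rowN b v t : ref_row (~~ b) v t = ref_row b t v.
Proof. by rewrite /ref_row; case: b => /=; rewrite eq_sym. Qed.

Lemma coef_far b v x a S : vrow x != vrow v -> ~~ ref_row b v x ->
  coef b v (add_delta x a S) = coef b v S.
Proof.
move=> rx fx; have xv : x != v by apply: contraNneq rx => ->.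
by rewrite /coef !denomE !diffs_add // /row_mates (negbTE rx).
Qed.

(** This lemma and its variants below isolate the dependence of a coefficient on one or two entries
    and hide the rest in a constant [K], so that relations between coefficients become identities in
    a few variables. *)
Lemma coef_ref b v x S : ref_row b v x ->
  exists K, forall a, coef b v (add_delta x a S) = K * (S v - S x - a).
Proof.
move=> rx; have rxv := ref_row_neq rx.
have xv : x != v by apply: contraNneq rxv => ->.
exists (- sg b * diffs (fun t => ref_row b v t && (t != x)) S v / denom S v) => a.
rewrite /coef (diffsD1 _ _ rx) !denomE.
rewrite !diffs_add ?eqxx ?andbF //; last by rewrite /row_mates (negbTE rxv).
by rewrite add_eq add_neq 1?eq_sym //; ring.
Qed.

Lemma coef_ref2 b v x y S : ref_row b v x -> ref_row b v y -> x != y ->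
  exists K, forall a a', coef b v (add_delta x a (add_delta y a' S)) =
    K * (S v - S x - a) * (S v - S y - a').
Proof.
move=> rx ry xy; have rxv := ref_row_neq rx; have ryv := ref_row_neq ry.
have xv : x != v by apply: contraNneq rxv => ->.
have yv : y != v by apply: contraNneq ryv => ->.
exists (- sg b * diffs (fun t => ref_row b v t && (t != x) && (t != y)) S v /
  denom S v) => a a'.
have ry' : ref_row b v y && (y != x) by rewrite ry eq_sym.
rewrite /coef (diffsD1 _ _ rx) (diffsD1 _ _ ry') !denomE.
rewrite !diffs_add ?eqxx ?andbF // ?/row_mates ?(negbTE rxv) ?(negbTE ryv) //.
rewrite add_eq add_neq 1?eq_sym // add_neq 1?eq_sym // add_neq //.
by rewrite [add_delta x _ _ y]add_neq 1?eq_sym // add_eq; ring.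
Qed.

Lemma coef_row b v y S : vrow y = vrow v -> y != v ->
  exists K, forall a, coef b v (add_delta y a S) = K / (S v - S y - a).
Proof.
move=> ry yv; have my : row_mates v y by rewrite /row_mates ry eqxx.
have fy := ref_row_notin b ry.
exists (- sg b * diffs (ref_row b v) S v /
  diffs (fun t => row_mates v t && (t != y)) S v) => a.
rewrite /coef !denomE (diffsD1 _ _ my) invfM !diffs_add ?eqxx ?andbF //.
by rewrite add_eq add_neq 1?eq_sym // opprD addrA; ring.
Qed.

Lemma coef_ref_row b v x y S : ref_row b v x -> vrow y = vrow v -> y != v ->
  exists K, forall a a', coef b v (add_delta x a (add_delta y a' S)) =
    K * (S v - S x - a) / (S v - S y - a').
Proof.
move=> rx ry yv; have my : row_mates v y by rewrite /row_mates ry eqxx.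
have rxv := ref_row_neq rx; have fy := ref_row_notin b ry.
have xv : x != v by apply: contraNneq rxv => ->.
have yx : y != x by apply: contraNneq rxv => <-; rewrite ry.
exists (- sg b * diffs (fun t => ref_row b v t && (t != x)) S v /
  diffs (fun t => row_mates v t && (t != y)) S v) => a a'.
rewrite /coef !denomE (diffsD1 _ _ my) (diffsD1 _ _ rx) invfM.
rewrite !diffs_add ?eqxx ?andbF // ?(negbTE fy) // /row_mates ?(negbTE rxv) //.
have -> : add_delta x a (add_delta y a' S) v = S v.
  by rewrite add_neq 1?eq_sym // add_neq // eq_sym.
have -> : add_delta x a (add_delta y a' S) x = S x + a.
  by rewrite add_eq add_neq // eq_sym.
have -> : add_delta x a (add_delta y a' S) y = S y + a'.
  by rewrite add_neq // add_eq.
by rewrite !opprD !addrA; ring.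
Qed.

Lemma coef_eq0 b v t S : ref_row b v t -> S v = S t -> coef b v S = 0.
Proof. by move=> rt e; rewrite /coef (diffsD1 _ _ rt) e subrr mul0r mulr0 mul0r. Qed.

End GelfandTsetlin.

(** * Paths of moves and truncation to realizations *)

Section Paths.
Variables (C : numFieldType) (n : nat) (G : graph n) (L : tableau C n).
Implicit Types (u v w x y t : vertex n) (S : tableau C n) (b c : bool).
Implicit Types (p : seq (bool * vertex n)).

Hypothesis adjG : adjacent_arrows G.

(** Being a basis tableau splits into three conditions with different behaviour along a path:
    [in_lattice] is preserved by every move below the top row, while with nonzero coefficients
    [down_ok] propagates forwards and [up_ok] backwards. *)
Definition in_lattice S : Prop :=
  (forall u v, vrow u = vrow v -> ~~ vtop u -> is_int (S u - S v) ->
     same_component G u v) /\ integral_shift L S.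
Definition down_ok S : Prop := forall u v, arrow G u v ->
  vrow v != (vrow u).+1 :> nat -> is_nneg (S u - S v).
Definition up_ok S : Prop := forall u v, arrow G u v ->
  vrow v == (vrow u).+1 :> nat -> is_pos (S u - S v).

Lemma goodP S : good G L S <-> [/\ in_lattice S, down_ok S & up_ok S].
Proof.
split=> [/asboolP[[sat int] shift]|[[int shift] dn up]].
  split=> // u v uv; have := sat u v uv; first by case: ifP.
  by move=> + h; rewrite h.
apply/asboolP; split=> //; split=> // u v uv.
by case: ifPn => h; [apply: up|apply: dn].
Qed.

Lemma is_int_sg b : is_int (sg C b).
Proof. by case: b; [exists 1|exists (-1)]; rewrite ?mulrN1z //= mulr1z. Qed.

Lemma in_lattice_step b v S : ~~ vtop v -> in_lattice S -> in_lattice (step b v S).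
Proof.
move=> tv [int [z [z0 eS]]]; subst S; split.
  move=> u w euw tu hi; apply: int => //.
  have [m hm] := hi; have [e he] := is_int_sg b.
  exists (m - (if u == v then e else 0) + (if w == v then e else 0)).
  rewrite rmorphD rmorphB /= -hm /step /add_delta !ffunE.
  by case: (u == v); case: (w == v); rewrite -?he ?mulr0z; ring.
have [e he] := is_int_sg b.
exists (fun x => z x + (if x == v then e else 0)); split.
  move=> x tx; rewrite z0 // add0r; case: eqP => // exv.
  by rewrite -exv tx in tv.
apply/ffunP => x; rewrite /step /add_delta !ffunE rmorphD /= addrA.
by case: eqP; rewrite ?he.
Qed.

(* A move with nonzero coefficient never breaks a downward arrow and never
   repairs an upward one. *)
Lemma coef_down b v S : ~~ vtop v -> coef b v S != 0 -> down_ok S -> down_ok (step b v S).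
Proof.
move=> tv c0 dn u w uw h; have [m hm] := dn u w uw h.
have [euv|nuv] := eqVneq u v; have [ewv|nwv] := eqVneq w v.
- by subst u; subst w; have [||[tt _]] := adjG uw; [lia..|rewrite tt in tv].
- subst u; rewrite add_eq add_neq //.
  case: b c0 => c0; rewrite /sg.
    by exists m.+1; rewrite -natr1 -hm; ring.
  (* Lowering [v] can only break the arrow when [S v = S w]; then [w] lies in the row below, which
     enters the numerator, and the coefficient is zero. *)
  case: m hm => [|m] hm; last first.
    by exists m; apply: (addIr 1); rewrite natr1 -hm; ring.
  case/eqP: c0; apply: (@coef_eq0 _ _ _ _ w); last by apply/eqP; rewrite -subr_eq0 hm.
  rewrite /ref_row; have [->||[tt]] := adjG uw; rewrite ?eqxx //.
    by move/eqP; rewrite (negbTE h).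
  by rewrite tt in tv.
- subst w; rewrite add_eq add_neq //.
  case: b c0 => c0; rewrite /sg; last first.
    by exists m.+1; rewrite -natr1 -hm; ring.
  case: m hm => [|m] hm; last first.
    by exists m; apply: (addIr 1); rewrite natr1 -hm; ring.
  case/eqP: c0; apply: (@coef_eq0 _ _ _ _ u); last first.
    by apply/esym/eqP; rewrite -subr_eq0 hm.
  rewrite /ref_row; have [->||[_ tt]] := adjG uw; rewrite ?eqxx //.
    by move/eqP; rewrite (negbTE h).
  by rewrite tt in tv.
- by rewrite !add_neq //; exists m.
Qed.

Lemma coef_up b v S : coef b v S != 0 -> up_ok (step b v S) -> up_ok S.
Proof.
move=> c0 up u w uw h; have [m hm] := up u w uw h.
have uNw : u != w by apply/eqP => e; subst w; move/eqP: h; lia.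
have [euv|nuv] := eqVneq u v; have [ewv|nwv] := eqVneq w v.
- by subst u; subst w; rewrite eqxx in uNw.
- subst u; move: hm; rewrite add_eq add_neq // => hm.
  have {}hm : S v - S w = m.+1%:R - sg C b by rewrite -hm; ring.
  case: b c0 hm {up} => c0; rewrite /sg => hm; last first.
    by exists m.+1; rewrite hm -[in RHS]natr1; ring.
  case: m hm => [|m] hm; last by exists m; rewrite hm -[in LHS]natr1; ring.
  case/eqP: c0; apply: (@coef_eq0 _ _ _ _ w) => //.
  by apply/eqP; rewrite -subr_eq0 hm subrr.
- subst w; move: hm; rewrite add_eq add_neq // => hm.
  have {}hm : S u - S v = m.+1%:R + sg C b by rewrite -hm; ring.
  case: b c0 hm {up} => c0; rewrite /sg => hm.
    by exists m.+1; rewrite hm -[in RHS]natr1; ring.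
  case: m hm => [|m] hm; last by exists m; rewrite hm -[in LHS]natr1; ring.
  case/eqP: c0; apply: (@coef_eq0 _ _ _ _ u).
    by rewrite /ref_row eq_sym.
  by apply/esym/eqP; rewrite -subr_eq0 hm subrr.
- by move: hm; rewrite !add_neq // => hm; exists m.
Qed.

Definition tcoef b v S : C :=
  if good G L S && good G L (step b v S) then coef b v S else 0.

Fixpoint target p S : tableau C n :=
  if p is m :: p' then target p' (step m.1 m.2 S) else S.
Fixpoint cpath p S : C :=
  if p is m :: p' then coef m.1 m.2 S * cpath p' (step m.1 m.2 S) else 1.
Fixpoint tpath p S : C :=
  if p is m :: p' then tcoef m.1 m.2 S * tpath p' (step m.1 m.2 S) else 1.

Definition movable p : bool := all (fun m => ~~ vtop m.2) p.

(** If the product of coefficients vanishes, so does the truncated one. Otherwise [down_ok] comes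
    from the start and [up_ok] from the end, so every tableau on the way is a realization and
    nothing is truncated. *)
Lemma tpathE p S : movable p -> good G L S -> good G L (target p S) ->
  tpath p S = cpath p S.
Proof.
move=> mp gS gT.
have [/eqP c0|c0] := boolP (cpath p S == 0).
  rewrite c0; elim: p S c0 {mp gS gT} => [|m p IH] S /= => [/eqP|].
    by rewrite oner_eq0.
  move/eqP; rewrite mulf_eq0 /tcoef => /orP[] /eqP c0.
    by case: ifP => _; rewrite ?c0 mul0r.
  by rewrite IH ?mulr0.
have dn q S' : movable q -> cpath q S' != 0 -> in_lattice S' -> down_ok S' ->
    in_lattice (target q S') /\ down_ok (target q S').
  elim: q S' => [|m q IH] S' //= /andP[tm mq].
  rewrite mulf_eq0 negb_or => /andP[cm cq] lat dn; apply: IH => //.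
    exact: in_lattice_step.
  exact: coef_down.
have up q S' : cpath q S' != 0 -> up_ok (target q S') -> up_ok S'.
  elim: q S' => [|m q IH] S' //=; rewrite mulf_eq0 negb_or => /andP[cm cq].
  by move/(IH _ cq); apply: coef_up.
elim: p S mp gS gT c0 => [|m p IH] S //= /andP[tm mp] gS gT.
rewrite mulf_eq0 negb_or => /andP[cm cp].
have gS' : good G L (step m.1 m.2 S).
  have /goodP[lat dnS _] := gS; have /goodP[_ _ upT] := gT.
  apply/goodP; split; [exact: in_lattice_step|exact: coef_down|exact: up upT].
by rewrite /tcoef gS gS' IH.
Qed.

Lemma vecT_out S : ~~ good G L S -> vecT G L S = 0.
Proof.
move=> gS; rewrite /vecT; case: insubP => // b.
by rewrite -/(good G L S) (negbTE gS).
Qed.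

Lemma vecT_val (s : basisVG G L) : vecT G L (val s) = << s >>.
Proof. by rewrite /vecT valK. Qed.

Lemma vecT_good S : good G L S ->
  exists2 s : basisVG G L, val s = S & vecT G L S = << s >>.
Proof.
move=> gS; rewrite /vecT; case: insubP => [s _ <-|]; first by exists s.
by rewrite -/(good G L S) gS.
Qed.

Fact mono_key : unit. Proof. by []. Qed.
(** The contribution of one path to a word in the generators; the head of the path is the move made
    first. *)
Definition mono : seq (bool * vertex n) -> tableau C n -> VG G L :=
  locked_with mono_key (fun p S => tpath p S *: vecT G L (target p S)).

Lemma mono_def p S : mono p S = tpath p S *: vecT G L (target p S).
Proof. by rewrite /mono unlock. Qed.

Lemma mono_cons m p S : mono (m :: p) S = tcoef m.1 m.2 S *: mono p (step m.1 m.2 S).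
Proof. by rewrite !mono_def /= scalerA. Qed.

Fact gen_key : unit. Proof. by []. Qed.
Definition gen : bool -> nat -> basisVG G L -> VG G L :=
  locked_with gen_key (fun b k s =>
  \sum_(v | vrow v == k :> nat) coef b v (val s) *: vecT G L (step b v (val s))).

Lemma genE b k s : gen b k s =
  \sum_(v | vrow v == k :> nat) coef b v (val s) *: vecT G L (step b v (val s)).
Proof. by rewrite /gen unlock. Qed.

Lemma gen_vecT b k S :
  lin_ext (gen b k) (vecT G L S) =
  \sum_(v | vrow v == k :> nat) tcoef b v S *: vecT G L (step b v S).
Proof.
have [gS|bS] := boolP (good G L S); last first.
  rewrite vecT_out // linear0 big1 // => v _.
  by rewrite /tcoef (negbTE bS) scale0r.
have [s sS ->] := vecT_good gS; rewrite lin_extU genE sS; apply: eq_bigr => v _.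
rewrite /tcoef gS /=; have [//|bS'] := boolP (good G L _).
by rewrite (vecT_out bS') scale0r scaler0.
Qed.

(** Applying a generator appends a last move to each path, so that words in the generators expand
    into sums over paths. *)
Lemma gen_mono b k p S :
  lin_ext (gen b k) (mono p S) =
  \sum_(v | vrow v == k :> nat) mono (rcons p (b, v)) S.
Proof.
elim: p S => [|m p IH] S.
  rewrite mono_def /= scale1r gen_vecT; apply: eq_bigr => v _; rewrite mono_def /=.
  by rewrite mulr1.
rewrite mono_cons lin_extZ IH scaler_sumr.
by apply: eq_bigr => v _; rewrite rcons_cons mono_cons.
Qed.

End Paths.

(** * Commutation and Serre identities between coefficients *)

Section Relations.
Variables (C : numFieldType) (n : nat) (G : graph n) (L : tableau C n).
Implicit Types (u v w x y t : vertex n) (S : tableau C n) (b c : bool).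
Implicit Types (p : seq (bool * vertex n)).

Hypothesis adjG : adjacent_arrows G.

Hypothesis sepG : separated C G.

Local Notation good := (good G L).
Local Notation mono := (@mono C n G L).

Lemma monoE p S : movable p -> good S ->
  mono p S = (if good (target p S) then cpath p S else 0) *: vecT G L (target p S).
Proof.
move=> mp gS; have [gT|bT] := boolP (good (target p S)).
  by rewrite mono_def (tpathE adjG).
by rewrite mono_def (vecT_out bT) scale0r scaler0.
Qed.

Lemma mono_comm b c v w S : ~~ vtop v -> ~~ vtop w -> good S ->
  coef b v S * coef c w (step b v S) = coef c w S * coef b v (step c w S) ->
  mono [:: (b, v); (c, w)] S = mono [:: (c, w); (b, v)] S.
Proof.
move=> tv tw gS e.
have mp : movable [:: (b, v); (c, w)] by rewrite /movable /= tv tw.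
have mq : movable [:: (c, w); (b, v)] by rewrite /movable /= tv tw.
rewrite (monoE mp gS) (monoE mq gS).
have -> : cpath [:: (c, w); (b, v)] S = cpath [:: (b, v); (c, w)] S.
  by rewrite /= !mulr1.
have -> // : target [:: (c, w); (b, v)] S = target [:: (b, v); (c, w)] S.
by rewrite /= stepC.
Qed.

Lemma coef_comm_far b c v w S : vrow v != vrow w ->
  ~~ ref_row b v w -> ~~ ref_row c w v ->
  coef b v S * coef c w (step b v S) = coef c w S * coef b v (step c w S).
Proof.
move=> vw rv rw; have wv : vrow w != vrow v by rewrite eq_sym.
by rewrite /step (coef_far _ _ vw rw) (coef_far _ _ wv rv) mulrC.
Qed.

(** If the two entries influence each other, both orders produce the same factors, [S v - S w] and
    [S v - S w + sg C b] up to signs, either in the numerators or in the denominators. In the latter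
    case this stays true under the convention [x / 0 = 0]. *)
Lemma coef_comm_opp b v w S : v != w ->
  coef b v S * coef (~~ b) w (step b v S) = coef (~~ b) w S * coef b v (step (~~ b) w S).
Proof.
move=> vw; have sN : sg C (~~ b) = - sg C b by case: b; rewrite /sg /= ?opprK.
have [evw|rvw] := eqVneq (vrow v) (vrow w).
  have wv : w != v by rewrite eq_sym.
  have [K hK] := coef_row b S (esym evw) wv.
  have [K' hK'] := coef_row (~~ b) S evw vw.
  have := hK 0; have := hK' 0; rewrite !add_delta0 !subr0 => -> ->.
  rewrite /step hK hK' sN opprK -[S w - S v]opprB.
  by rewrite -opprD !invrN; ring.
have [r|r] := boolP (ref_row b v w); last first.
  by apply: coef_comm_far => //; rewrite ref_rowN.
have r' : ref_row (~~ b) w v by rewrite ref_rowN.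
have [K hK] := coef_ref S r; have [K' hK'] := coef_ref S r'.
have := hK 0; have := hK' 0; rewrite !add_delta0 !subr0 => -> ->.
by rewrite /step hK hK' sN; ring.
Qed.

(** Along [v -> u -> w] and [v -> t -> w] the total drop [1] is a sum of a nonnegative integer and a
    positive one. The upward arrow, being strict, takes all of it, and the downward arrow joins
    equal entries. *)
Lemma squeezed S v w : good S -> vrow v = vrow w -> ~~ vtop v -> S v = S w + 1 ->
  exists u t, [/\ (vrow u).+1 = vrow v :> nat, vrow t = (vrow v).+1 :> nat,
    arrow G v u /\ arrow G u w, arrow G v t /\ arrow G t w & S u = S v /\ S t = S w].
Proof.
move=> gS vw tv e; have /asboolP[rS _] := gS; have /goodP[_ dn up] := gS.
have nvw : v != w.
  by apply/eqP => evw; move/eqP: e; rewrite evw -subr_eq0 opprD addNKr oppr_eq0 oner_eq0.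
have [_ /(_ e)[u [t [ru rt [vu uw] [vt tw]]]]] := sepG rS vw tv nvw.
have rvw : (vrow v : nat) = vrow w by rewrite vw.
exists u, t; split=> //.
have sum1 (m1 m2 : nat) (z1 z2 : C) : z1 = m1.+1%:R -> z2 = m2%:R -> z1 + z2 = 1 ->
    z2 = 0.
  move=> -> ->; rewrite -natrD -[X in _ = X]/(1%:R) => /eqP.
  by rewrite eqr_nat => /eqP h; rewrite (_ : m2 = 0%N) //; lia.
split.
  have [m1 h1] : is_nneg (S v - S u) by apply: dn => //; apply/eqP; lia.
  have [m2 h2] : is_pos (S u - S w) by apply: up => //; rewrite -rvw ru.
  apply/esym/eqP; rewrite -subr_eq0; apply/eqP.
  by apply: sum1 h2 h1 _; rewrite e; ring.
have [m1 h1] := up _ _ vt (introT eqP rt).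
have [m2 h2] : is_nneg (S t - S w) by apply: dn => //; apply/eqP; lia.
by apply/eqP; rewrite -subr_eq0; apply/eqP/(sum1 _ _ _ _ h1 h2); rewrite e; ring.
Qed.

(* The entry in the untouched row that lies between two adjacent entries [S v]
   and [S w] prevents them from moving together. *)
Lemma blocked b c S S' v w : good S -> good S' -> vrow v = vrow w -> ~~ vtop v ->
  (forall t, ref_row c v t -> S' t = S t) ->
  S' v = S v + sg C b -> S' w = S w + sg C b -> S v <> S w + 1.
Proof.
move=> gS gS' vw tv fix_ e1 e2 e.
have [u [t [ru rt [vu uw] [vt tw] [eu et]]]] := squeezed gS vw tv e.
have /goodP[_ dn' up'] := gS'.
have rvw : (vrow v : nat) = vrow w by rewrite vw.
have one_neq0 (m : nat) : 0 <> m.+1%:R :> C.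
  by move/esym/eqP; rewrite pnatr_eq0.
have no_neg (m : nat) : -1 <> m%:R :> C.
  by move=> h; apply: (one_neq0 m); rewrite -natr1 -h addNr.
case: c fix_ => fix_.
  have eT : S' t = S w by rewrite fix_ // /ref_row rt.
  have [m3 h3] := up' _ _ vt (introT eqP rt).
  have [m4 h4] : is_nneg (S' t - S' w) by apply: dn' => //; apply/eqP; lia.
  have {}h3 : 1 + sg C b = m3.+1%:R by rewrite -h3 eT e1 e; ring.
  have {}h4 : - sg C b = m4%:R by rewrite -h4 eT e2; ring.
  case: b h3 h4 {e1 e2}; rewrite /sg => h3 h4; first exact: (no_neg m4).
  by apply: (one_neq0 m3); rewrite -h3 subrr.
have eU : S' u = S v by rewrite fix_ // /ref_row ru.
have [m3 h3] : is_nneg (S' v - S' u) by apply: dn' => //; apply/eqP; lia.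
have [m4 h4] : is_pos (S' u - S' w) by apply: up' => //; rewrite -rvw ru.
have {}h3 : sg C b = m3%:R by rewrite -h3 eU e1; ring.
have {}h4 : 1 - sg C b = m4.+1%:R by rewrite -h4 eU e2 e; ring.
case: b h3 h4 {e1 e2}; rewrite /sg => h3 h4; last exact: (no_neg m3).
by apply: (one_neq0 m4); rewrite -h4 subrr.
Qed.

(** Supplies the nonvanishing denominators of the Serre identities: [v] and [w] both move in
    direction [b] while the neighbouring row on side [c] stays fixed. *)
Lemma nonadjacent b c S S' v w : good S -> good S' -> vrow v = vrow w ->
  ~~ vtop v -> v != w -> (forall t, ref_row c v t -> S' t = S t) ->
  S' v = S v + sg C b -> S' w = S w + sg C b ->
  [/\ S v - S w != 0, S v - S w - sg C b != 0 & S w - S v - sg C b != 0].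
Proof.
move=> gS gS' vw tv nvw fix_ e1 e2; have /asboolP[rS _] := gS.
have nv : S v <> S w + 1 by apply: (blocked gS gS' vw tv fix_ e1 e2).
have nw : S w <> S v + 1.
  apply: (blocked (c := c) gS gS' (esym vw) _ _ e2 e1).
    by move: tv; rewrite /vtop vw.
  by move=> t rt; apply: fix_; move: rt; rewrite /ref_row vw.
have [nvw0 _] := sepG rS vw tv nvw.
have sgE : sg C b = 1 \/ sg C b = -1 by rewrite /sg; case: (b); [left|right].
split; apply/eqP => h.
- by apply: nvw0; apply/eqP; rewrite -subr_eq0 h.
- case: sgE => e; rewrite e in h.
    by apply: nv; rewrite -[LHS]subr0 -h; ring.
  by apply: nw; rewrite -[RHS]subr0 -h; ring.
- case: sgE => e; rewrite e in h.
    by apply: nw; rewrite -[LHS]subr0 -h; ring.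
  by apply: nv; rewrite -[RHS]subr0 -h; ring.
Qed.

(** The identity is symmetrised over the two moves [x], [x'] of one row. Here [y] enters the
    numerators of both, so their coefficients are linear in [S y]; the fixed row is the one on the
    side opposite to [y], hence [~~ b] in [nonadjacent]. *)
Lemma serre_scalar_ref b S x x' y : good S ->
  good (step b y (step b x (step b x' S))) ->
  ~~ vtop x -> vrow x = vrow x' -> ref_row b x y ->
  let ph (v1 v2 v3 : vertex n) := cpath [:: (b, v1); (b, v2); (b, v3)] S in
  (ph y x' x - ph x' y x *+ 2 + ph x' x y) +
  (ph y x x' - ph x y x' *+ 2 + ph x x' y) = 0.
Proof.
move=> gS gT tx xx' rxy ph.
have rx'y : ref_row b x' y by move: rxy; rewrite /ref_row xx'.
have nyx := ref_row_neq rxy; have nyx' := ref_row_neq rx'y.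
have yx : y != x by apply: contraNneq nyx => ->.
have yx' : y != x' by apply: contraNneq nyx' => ->.
have ryx : ~~ ref_row b y x.
  by move: rxy; rewrite /ref_row; case: (b) => /eqP h; apply/eqP; lia.
have ryx' : ~~ ref_row b y x' by move: ryx; rewrite /ref_row xx'.
have cy1 S' : coef b y (step b x S') = coef b y S' by apply: coef_far; rewrite // eq_sym.
have cy2 S' : coef b y (step b x' S') = coef b y S' by apply: coef_far; rewrite // eq_sym.
rewrite /ph /= !mulr1 !(cy1, cy2) {ph cy1 cy2}; set cy := coef b y S.
have [exx|nxx] := eqVneq x x'.
  subst x'; have [K0 h0] := coef_ref S rxy.
  have [K1 h1] := coef_ref (step b x S) rxy.
  have e0 : coef b x S = K0 * (S x - S y) by rewrite -{1}[S](add_delta0 y) h0 subr0.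
  have e1 : coef b x (step b x S) = K1 * (S x - S y + sg C b).
    by rewrite -{1}[step b x S](add_delta0 y) h1 add_eq add_neq // subr0 addrAC.
  have e0y : coef b x (step b y S) = K0 * (S x - S y - sg C b) by rewrite h0.
  have e1y : coef b x (step b y (step b x S)) = K1 * (S x - S y).
    by rewrite h1 add_eq add_neq //; ring.
  have e1y' : coef b x (step b x (step b y S)) = K1 * (S x - S y).
    by rewrite -e1y /step add_deltaC.
  by rewrite e0 e1 e0y e1y e1y'; ring.
have nx'x : x' != x by rewrite eq_sym.
have [K hK] := coef_ref_row S rxy (esym xx') nx'x.
have [K' hK'] := coef_ref_row S rx'y xx' nxx.
have [d0 d1 d2] : [/\ S x - S x' != 0, S x - S x' - sg C b != 0 &
    S x' - S x - sg C b != 0].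
  apply: (nonadjacent (c := ~~ b) gS gT) => //.
  - move=> t rt; rewrite !add_neq //; apply: contraTneq rt => ->.
    + by apply: ref_row_notin; rewrite xx'.
    + exact: ref_row_notin.
    + by rewrite ref_rowN.
  - by rewrite add_neq 1?eq_sym // add_eq add_neq.
  - by rewrite add_neq 1?eq_sym // add_neq // add_eq.
have hx a a' : coef b x (add_delta x' a' (add_delta y a S)) =
    K * (S x - S y - a) / (S x - S x' - a') by rewrite add_deltaC hK.
have hx' a a' : coef b x' (add_delta x a' (add_delta y a S)) =
    K' * (S x' - S y - a) / (S x' - S x - a') by rewrite add_deltaC hK'.
have := (hK 0 0, hK 0 (sg C b), hx (sg C b) 0).
have := (hK' 0 0, hK' 0 (sg C b), hx' (sg C b) 0).
rewrite !add_delta0 !subr0 => -[[e1 e2] e3] [[f1 f2] f3].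
rewrite /step hK hx hK' hx' e1 e2 e3 f1 f2 f3 {hK hx hK' hx' e1 e2 e3 f1 f2 f3}.
have d3 : S x' - S x != 0 by rewrite -opprB oppr_eq0.
by field; rewrite d0 d1 d2 d3.
Qed.

(** The mirror case: the coefficient of [y] contains the factors of [x] and [x'], whereas theirs do
    not see [y]. The fixed row is now on side [b]. *)
Lemma serre_scalar_coref b S x x' y : good S ->
  good (step b y (step b x (step b x' S))) ->
  ~~ vtop x -> vrow x = vrow x' -> ref_row b y x ->
  let ph (v1 v2 v3 : vertex n) := cpath [:: (b, v1); (b, v2); (b, v3)] S in
  (ph y x' x - ph x' y x *+ 2 + ph x' x y) +
  (ph y x x' - ph x y x' *+ 2 + ph x x' y) = 0.
Proof.
move=> gS gT tx xx' ryx ph.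
have ryx' : ref_row b y x' by move: ryx; rewrite /ref_row xx'.
have nxy := ref_row_neq ryx; have nxy' := ref_row_neq ryx'.
have xy : x != y by apply: contraNneq nxy => ->.
have xy' : x' != y by apply: contraNneq nxy' => ->.
have rxy : ~~ ref_row b x y.
  by move: ryx; rewrite /ref_row; case: (b) => /eqP h; apply/eqP; lia.
have rxy' : ~~ ref_row b x' y by move: rxy; rewrite /ref_row xx'.
have cx S' : coef b x (step b y S') = coef b x S' by apply: coef_far; rewrite // eq_sym.
have cx' S' : coef b x' (step b y S') = coef b x' S'.
  by apply: coef_far; rewrite // eq_sym.
rewrite /ph /= !mulr1 !(stepC b b _ y) !(cx, cx') {ph cx cx'}.
have [exx|nxx] := eqVneq x x'.
  subst x'; have [K h] := coef_ref S ryx.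
  have := (h 0, h (sg C b), h (sg C b + sg C b)).
  rewrite -add_deltaD add_delta0 subr0 => -[[e0 e1] e2].
  by rewrite /step e0 e1 e2; ring.
have nx'x : x' != x by rewrite eq_sym.
have [K hK] := coef_ref2 S ryx ryx' nxx.
have [K1 h1] := coef_row b S (esym xx') nx'x.
have [K2 h2] := coef_row b S xx' nxx.
have [d0 d1 d2] : [/\ S x - S x' != 0, S x - S x' - sg C b != 0 &
    S x' - S x - sg C b != 0].
  apply: (nonadjacent (c := b) gS gT) => //.
  - move=> t rt; rewrite !add_neq //; apply: contraTneq rt => ->.
    + by apply: ref_row_notin; rewrite xx'.
    + exact: ref_row_notin.
    + by [].
  - by rewrite add_neq // add_eq add_neq.
  - by rewrite add_neq // add_neq // add_eq.
have hK' a a' : coef b y (add_delta x' a' (add_delta x a S)) =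
    K * (S y - S x - a) * (S y - S x' - a') by rewrite add_deltaC hK.
have := (hK 0 0, hK 0 (sg C b), hK' (sg C b) 0).
have := (h1 0, h2 0); rewrite !add_delta0 !subr0 => -[e1 e2] [[f1 f2] f3].
rewrite /step hK hK' h1 h2 e1 e2 f1 f2 f3 {hK hK' h1 h2 e1 e2 f1 f2 f3}.
have d3 : S x' - S x != 0 by rewrite -opprB oppr_eq0.
by field; rewrite d0 d1 d2 d3.
Qed.

End Relations.

(** * The commutator of opposite generators on one row *)

Section DiagonalRelation.
Variables (C : numFieldType) (n : nat) (G : graph n) (L : tableau C n).
Implicit Types (u v w x y t : vertex n) (S : tableau C n).

Hypothesis sepG : separated C G.

Lemma card_row k : (k < n)%N -> #|[pred v : vertex n | vrow v == k :> nat]| = k.+1.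
Proof.
move=> kn; pose f (i : 'I_k.+1) : 'I_n := Ordinal (leq_trans (ltn_ord i) kn).
have fP (i : 'I_k.+1) : ((Ordinal kn, f i).2 <= (Ordinal kn, f i).1)%N.
  by rewrite /= -ltnS.
pose g (i : 'I_k.+1) : vertex n := exist _ (Ordinal kn, f i) (fP i).
rewrite -[RHS]card_ord -(card_imset predT (f := g)); last first.
  move=> i j /(congr1 (fun v => vcol v : nat)) /= e; exact/val_inj.
rewrite -[LHS](cardsE) ; apply: eq_card => v; rewrite !inE.
apply/eqP/imsetP => [rv|[i _ ->] //].
have lv : (vcol v < k.+1)%N by rewrite ltnS -rv; exact: (valP v).
by exists (Ordinal lv) => //; apply: vertex_eq; apply: val_inj.
Qed.

(** The eigenvalue of the diagonal matrix unit of index [k], counted from [0]. *)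
Definition hval (k : nat) S : C :=
  k%:R + \sum_(v | vrow v == k :> nat) S v - \sum_(v | (vrow v).+1 == k :> nat) S v.

Let row k := enum [pred v : vertex n | vrow v == k :> nat].
Let low k := enum [pred v : vertex n | (vrow v).+1 == k :> nat].

Lemma size_low k : (k < n)%N -> size (low k) = k.
Proof.
move=> kn; rewrite -cardE; case: k kn => [|k] kn.
  by apply: eq_card0 => v; rewrite inE.
by rewrite -[RHS](card_row (ltnW kn)).
Qed.

Lemma sum_row k (F : vertex n -> C) :
  \sum_(v <- row k) F v = \sum_(v | vrow v == k :> nat) F v.
Proof. by rewrite big_enum. Qed.

Lemma diag_scalar k S : good G L S -> (k.+1 < n)%N ->
  \sum_(v | vrow v == k :> nat)
    (cpath [:: (false, v); (true, v)] S - cpath [:: (true, v); (false, v)] S) =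
  hval k S - hval k.+1 S.
Proof.
move=> gS kn; have kn' := ltnW kn.
(* Zeros [A] and poles [B] of a rational function whose residue at [S v - 1] is the coefficient of
   lowering then raising [v], and at [S v] minus that of raising then lowering. There are
   [(k + 2) + k] zeros and [2 (k + 1)] poles. *)
pose A := [seq S t | t <- row k.+1] ++ [seq S u - 1 | u <- low k].
pose B := [seq S v | v <- row k] ++ [seq S v - 1 | v <- row k].
have mem_row v j : (v \in row j) = (vrow v == j :> nat) by rewrite mem_enum.
have row_eq v w : v \in row k -> w \in row k -> vrow v = vrow w.
  by rewrite !mem_row => /eqP e /eqP e'; apply: ord_inj; rewrite e e'.
have top_row v : v \in row k -> ~~ vtop v by rewrite mem_row /vtop => /eqP ->; lia.
have /asboolP[rS _] := gS.
have injS : {in row k &, injective S}.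
  move=> v w vk wk e; apply/eqP; apply: contraT => nvw.
  have [|] := sepG rS _ (top_row v vk) nvw; last by rewrite e.
  exact: row_eq vk wk.
have res : residue_sum A B = \sum_(b <- B) b - \sum_(a <- A) a.
  apply: residue_sumE.
    rewrite !size_cat !size_map size_low // -!cardE !card_row //; lia.
  move=> b; rewrite !count_cat.
  have u1 : (count_mem b [seq S v | v <- row k] <= 1)%N.
    by rewrite count_uniq_mem ?leq_b1 // map_inj_in_uniq ?enum_uniq.
  have u2 : (count_mem b [seq (S v - 1)%R | v <- row k] <= 1)%N.
    rewrite count_uniq_mem ?leq_b1 // map_inj_in_uniq ?enum_uniq //.
    by move=> v w vk wk /addIr; apply: injS.
  move=> c2.
  have /mapP[w wk bw] : b \in [seq S v | v <- row k].
    by rewrite -has_pred1 has_count; lia.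
  have /mapP[v vk bv] : b \in [seq S v - 1 | v <- row k].
    by rewrite -has_pred1 has_count; lia.
  have evw : S v = S w + 1 by rewrite -bw bv subrK.
  have vw := row_eq _ _ vk wk.
  (* A double pole comes from [S v = S w + 1]. The squeezed entries give two zeros at the same
     point: [S t = S w] from the row above and [S u - 1 = S v - 1] from the row below. *)
  have [u [t [ru rt _ _ [eu et]]]] := squeezed sepG gS vw (top_row v vk) evw.
  have rv : vrow v = k :> nat by apply/eqP; rewrite -mem_row.
  have a1 : (0 < count_mem b [seq S t | t <- row k.+1])%N.
    rewrite -has_count has_pred1; apply/mapP; exists t; last by rewrite et.
    by rewrite mem_row rt rv.
  have a2 : (0 < count_mem b [seq (S u - 1)%R | u <- low k])%N.
    rewrite -has_count has_pred1; apply/mapP; exists u; last by rewrite eu -bv.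
    by rewrite mem_enum inE ru rv.
  lia.
have sumB : \sum_(b <- B) b - \sum_(a <- A) a = hval k S - hval k.+1 S.
  have const (r : seq (vertex n)) : \sum_(v <- r) (-1 : C) = - (size r)%:R.
    by rewrite sumrN -sum1_size natr_sum.
  have szr : size (row k) = k.+1 by rewrite -cardE card_row.
  rewrite /A /B !big_cat !big_map /= !big_split /= !const szr size_low //.
  rewrite /hval !sum_row /low big_enum /= -[k.+1%:R]natr1.
  rewrite (eq_bigl (fun v => vrow v == k :> nat) _ (fun v => eqSS _ _)).
  by ring.
rewrite -sumB -res /residue_sum big_cat !big_map /= -big_split /= -sum_row.
apply: eq_big_seq => v vk.
have uR : uniq (row k) by apply: enum_uniq.
have pv := perm_to_rem vk.
have den (F : vertex n -> C) :
    \prod_(w <- rem v (row k)) F w = \prod_(w | row_mates v w) F w.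
  rewrite (rem_filter _ uR) big_filter big_enum_cond; apply: eq_bigl => w.
  rewrite /row_mates inE; congr (_ && _); apply/eqP/eqP => [e|->].
    by apply: ord_inj; rewrite e; apply/esym/eqP; rewrite -mem_row.
  by apply/eqP; rewrite -mem_row.
have remB1 : perm_eq (rem (S v) B)
    ([seq S w | w <- rem v (row k)] ++ [seq S w - 1 | w <- row k]).
  rewrite perm_sym -(perm_cons (S v)) -(permPr (perm_to_rem _)); last first.
    by rewrite mem_cat map_f.
  by rewrite -cat_cons perm_cat2r -(map_cons S) perm_map // perm_sym.
have remB2 : perm_eq (rem (S v - 1) B)
    ([seq S w | w <- row k] ++ [seq S w - 1 | w <- rem v (row k)]).
  rewrite perm_sym -(perm_cons (S v - 1)) -(permPr (perm_to_rem _)); last first.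
    by rewrite mem_cat orbC (map_f (fun w => S w - 1)).
  rewrite -cat1s perm_catCA perm_cat2l cat1s.
  by rewrite -(map_cons (fun w => S w - 1)) perm_map // perm_sym.
rewrite (perm_big _ remB1) (perm_big _ remB2) /A !big_cat !big_map /=.
rewrite !(perm_big _ pv) /= !big_cons !den !mulr1.
have rv : vrow v = k :> nat by apply/eqP; rewrite -mem_row.
have own (P : pred (vertex n)) c : ~~ P v ->
    diffs P (step c v S) v = \prod_(t | P t) (S v + sg C c - S t).
  move=> Pv; apply: eq_bigr => t Pt; rewrite add_eq add_neq //.
  by apply: contraNneq Pv => <-.
have pr (F : vertex n -> C) :
    \prod_(t | ref_row true v t) F t = \prod_(t <- row k.+1) F t.
  by rewrite big_enum; apply: eq_bigl => t; rewrite /ref_row rv inE.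
have pl (F : vertex n -> C) :
    \prod_(t | ref_row false v t) F t = \prod_(t <- low k) F t.
  by rewrite big_enum; apply: eq_bigl => t; rewrite /ref_row rv inE.
rewrite /coef !denomE !own ?ref_row_notin // /row_mates ?eqxx ?andbF //.
rewrite /diffs -/(row_mates v) !pr !pl /sg.
have -> : S v - (S v - 1) = 1 by ring.
have -> : S v - 1 - S v = -1 by ring.
have e1 (r : seq (vertex n)) :
    \prod_(j <- r) (S v - (S j - 1)) = \prod_(j <- r) (S v + 1 - S j).
  by apply: eq_bigr => j _; ring.
have e2 (r : seq (vertex n)) :
    \prod_(j <- r) (S v - 1 - (S j - 1)) = \prod_(j <- r) (S v - S j).
  by apply: eq_bigr => j _; ring.
have -> : \prod_(w | row_mates v w) (S v - (S w - 1)) =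
    \prod_(w | row_mates v w) (S v + 1 - S w) by apply: eq_bigr => j _; ring.
have -> : \prod_(w | row_mates v w) (S v - 1 - (S w - 1)) =
    \prod_(w | row_mates v w) (S v - S w) by apply: eq_bigr => j _; ring.
by rewrite e1 e2 !invfM invrN invr1; ring.
Qed.
End DiagonalRelation.

(** * The Serre relations for the Gelfand-Tsetlin operators *)

Section SerreRelationsOfTableaux.
Variables (C : numFieldType) (n : nat) (G : graph n) (L : tableau C n).
Implicit Types (u v w x y t : vertex n) (S : tableau C n) (b c : bool).

Hypothesis adjG : adjacent_arrows G.

Hypothesis sepG : separated C G.

Local Notation good := (good G L).
Local Notation mono := (@mono C n G L).
Local Notation gen := (@gen C n G L).
Local Notation op b k := (lin_ext (gen b k)).
Local Notation vec := (vecT G L).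

Lemma vec_mono S : vec S = mono [::] S.
Proof. by rewrite mono_def /= scale1r. Qed.

Lemma word1 b k S : op b k (vec S) =
  \sum_(v | vrow v == k :> nat) mono [:: (b, v)] S.
Proof. by rewrite vec_mono; apply: gen_mono. Qed.

Lemma word2 b1 k1 b2 k2 S : op b2 k2 (op b1 k1 (vec S)) =
  \sum_(v | vrow v == k1 :> nat) \sum_(w | vrow w == k2 :> nat)
    mono [:: (b1, v); (b2, w)] S.
Proof.
by rewrite word1 lin_ext_sum; apply: eq_bigr => v _; apply: gen_mono.
Qed.

Lemma word3 b1 k1 b2 k2 b3 k3 S : op b3 k3 (op b2 k2 (op b1 k1 (vec S))) =
  \sum_(v | vrow v == k1 :> nat) \sum_(w | vrow w == k2 :> nat)
    \sum_(x | vrow x == k3 :> nat) mono [:: (b1, v); (b2, w); (b3, x)] S.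
Proof.
rewrite word2 lin_ext_sum; apply: eq_bigr => v _.
by rewrite lin_ext_sum; apply: eq_bigr => w _; apply: gen_mono.
Qed.

Lemma row_not_top v k : (k.+1 < n)%N -> vrow v == k :> nat -> ~~ vtop v.
Proof. by rewrite /vtop => kn /eqP ->; lia. Qed.

Lemma op_commute b c k l S : good S -> (k.+1 < n)%N -> (l.+1 < n)%N ->
  (forall v w, vrow v = k :> nat -> vrow w = l :> nat ->
     coef b v S * coef c w (step b v S) = coef c w S * coef b v (step c w S)) ->
  op c l (op b k (vec S)) = op b k (op c l (vec S)).
Proof.
move=> gS kn ln cm; rewrite !word2 [LHS]exchange_big.
apply: eq_bigr => w wl.
apply: eq_bigr => v vk.
apply: mono_comm => //; [exact: row_not_top vk|exact: row_not_top wl|].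
by apply: cm; apply/eqP.
Qed.

Lemma lin_comb6 (V : lmodType C) (z : V) (a1 a2 a3 a4 a5 a6 : C) :
  (a1 *: z - a2 *: z *+ 2 + a3 *: z) + (a4 *: z - a5 *: z *+ 2 + a6 *: z) =
  (a1 - a2 *+ 2 + a3 + (a4 - a5 *+ 2 + a6)) *: z.
Proof. by rewrite !scalerMnl -!scalerBl -!scalerDl. Qed.

(** All six paths end at the same tableau [T]. If [T] is no realization every term is zero;
    otherwise the relation is the scalar one. *)
Lemma serre_mono b S x x' y : good S -> ~~ vtop x -> ~~ vtop y -> vrow x = vrow x' ->
  ref_row b x y || ref_row b y x ->
  let m (v1 v2 v3 : vertex n) := mono [:: (b, v1); (b, v2); (b, v3)] S in
  (m y x' x - m x' y x *+ 2 + m x' x y) + (m y x x' - m x y x' *+ 2 + m x x' y) = 0.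
Proof.
move=> gS tx ty xx' rxy m; pose T := step b y (step b x (step b x' S)).
pose ph (v1 v2 v3 : vertex n) := cpath [:: (b, v1); (b, v2); (b, v3)] S.
have tx' : ~~ vtop x' by move: tx; rewrite /vtop xx'.
have mE v1 v2 v3 : ~~ vtop v1 -> ~~ vtop v2 -> ~~ vtop v3 ->
    step b v3 (step b v2 (step b v1 S)) = T ->
    m v1 v2 v3 = (if good T then ph v1 v2 v3 else 0) *: vec T.
  move=> t1 t2 t3 e; rewrite /m (monoE adjG) ?[target _ _]e //.
  by rewrite /movable /= t1 t2 t3.
have eT1 : step b x (step b x' (step b y S)) = T.
  by rewrite /T [step b x' _]stepC [step b x _]stepC.
have eT2 : step b x (step b y (step b x' S)) = T by rewrite /T [step b x _]stepC.
have eT3 : step b x' (step b x (step b y S)) = T.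
  by rewrite -eT1 stepC.
have eT4 : step b x' (step b y (step b x S)) = T.
  by rewrite -eT3; congr (step b x' _); rewrite stepC.
have eT5 : step b y (step b x' (step b x S)) = T.
  by rewrite /T [step b x' _]stepC.
rewrite (mE y x' x) // (mE x' y x) // (mE x' x y) // (mE y x x') // (mE x y x') //.
rewrite (mE x x' y) //; have [gT|_] := boolP (good T); last first.
  by rewrite scale0r mul0rn !subr0 !addr0.
rewrite lin_comb6.
suff -> : ph y x' x - ph x' y x *+ 2 + ph x' x y +
  (ph y x x' - ph x y x' *+ 2 + ph x x' y) = 0 by rewrite scale0r.
case/orP: rxy => r; first exact: (serre_scalar_ref sepG gS gT tx xx' r).
exact: (serre_scalar_coref sepG gS gT tx xx' r).
Qed.

Lemma op_serre b k l S : good S -> (k.+1 < n)%N -> (l.+1 < n)%N ->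
  (l == k.+1) || (k == l.+1) ->
  op b k (op b k (op b l (vec S))) + op b l (op b k (op b k (vec S))) =
  op b k (op b l (op b k (vec S))) *+ 2.
Proof.
move=> gS kn ln kl; apply/eqP; rewrite -subr_eq0 addrAC; apply/eqP.
rewrite !word3; pose m v1 v2 v3 := mono [:: (b, v1); (b, v2); (b, v3)] S.
pose H x' x := \sum_(y | vrow y == l :> nat) (m y x' x - m x' y x *+ 2 + m x' x y).
have -> : \sum_(y | vrow y == l :> nat) \sum_(x' | vrow x' == k :> nat)
    \sum_(x | vrow x == k :> nat) m y x' x =
  \sum_(x' | vrow x' == k :> nat) \sum_(x | vrow x == k :> nat)
    \sum_(y | vrow y == l :> nat) m y x' x.
  by rewrite [LHS]exchange_big; apply: eq_bigr => x' _; apply: exchange_big.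
have -> : \sum_(x' | vrow x' == k :> nat) \sum_(y | vrow y == l :> nat)
    \sum_(x | vrow x == k :> nat) m x' y x =
  \sum_(x' | vrow x' == k :> nat) \sum_(x | vrow x == k :> nat)
    \sum_(y | vrow y == l :> nat) m x' y x.
  by apply: eq_bigr => x' _; apply: exchange_big.
set R := (X in X = 0).
have RE : R = \sum_(x' | vrow x' == k :> nat) \sum_(x | vrow x == k :> nat) H x' x.
  rewrite /R -sumrMnl -sumrB -big_split; apply: eq_bigr => x' _ /=.
  rewrite -sumrMnl -sumrB -big_split; apply: eq_bigr => x _ /=.
  by rewrite -sumrMnl -sumrB -big_split.
(* Only the symmetrisation of the two moves in row [k] is known to vanish. Exchanging the two
   summation indices gives [R = - R], and [2] is invertible. *)
have anti x x' : vrow x == k :> nat -> vrow x' == k :> nat -> H x x' = - H x' x.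
  move=> xk x'k; apply/eqP; rewrite -addr_eq0; apply/eqP.
  rewrite -big_split big1 // => y yl /=; rewrite addrC.
  apply: serre_mono => //; [exact: row_not_top xk|exact: row_not_top yl| |].
    by apply: ord_inj; rewrite (eqP xk) (eqP x'k).
  by rewrite /ref_row (eqP xk) (eqP yl); case: (b); move: kl; lia.
have RN : R = - R.
  rewrite {1}RE exchange_big RE -sumrN; apply: eq_bigr => x' x'k /=.
  by rewrite -sumrN; apply: eq_bigr => x xk; apply: anti.
have /eqP : 2%:R *: R = 0 by rewrite scaler_nat mulr2n {1}RN addNr.
by rewrite scaler_eq0 pnatr_eq0 /= => /eqP.
Qed.

Lemma basis_good (s : basisVG G L) : good (val s).
Proof. exact: (valP s). Qed.

Lemma op_basis (g : basisVG G L -> VG G L) s : g s = lin_ext g (vec (val s)).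
Proof. by rewrite vecT_val lin_extU. Qed.

Fact cartan_key : unit. Proof. by []. Qed.
Definition cartan : nat -> basisVG G L -> VG G L :=
  locked_with cartan_key (fun k s => hval k (val s) *: << s >>).

Lemma cartanE k s : cartan k s = hval k (val s) *: << s >>.
Proof. by rewrite /cartan unlock. Qed.

Lemma cartan_vec k S : lin_ext (cartan k) (vec S) = hval k S *: vec S.
Proof.
have [gS|bS] := boolP (good S); last by rewrite (vecT_out bS) scaler0; apply: linear0.
by have [s sS ->] := vecT_good gS; rewrite lin_extU cartanE sS.
Qed.

Lemma hval_step k b v S : hval k (step b v S) - hval k S =
  sg C b *+ (k == vrow v) - sg C b *+ (k == (vrow v).+1).
Proof.
have shift (P : pred (vertex n)) :
    \sum_(w | P w) step b v S w = \sum_(w | P w) S w + sg C b *+ P v.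
  under eq_bigr do rewrite ffunE; rewrite big_split; congr (_ + _).
  rewrite -big_mkcondr /=; have [Pv|nPv] := boolP (P v).
    rewrite (big_pred1 v) ?mulr1n // => w /=.
    by case: eqP => [->|]; rewrite ?Pv ?andbF.
  by rewrite big_pred0 // => w; case: eqP => [->|]; rewrite ?andbF ?(negbTE nPv).
rewrite /hval !shift ![_ == k]eq_sym; ring.
Qed.

Lemma lin_comb_weight (V : lmodType C) (z : V) (a h1 h2 e : C) (m m' : bool) :
  h1 - h2 = e *+ m - e *+ m' ->
  a *: (h1 *: z) - h2 *: (a *: z) = e *: ((a *: z) *+ m - (a *: z) *+ m').
Proof.
move=> h; rewrite !scalerMnl -scalerBl !scalerA -scalerBl; congr (_ *: _).
rewrite [h2 * _]mulrC -mulrBr h.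
by case: m {h}; case: m'; rewrite ?mulr1n ?mulr0n; ring.
Qed.

Lemma cartan_gen k b l s : end_bracket (cartan k) (gen b l) s =
  sg C b *: (gen b l s *+ (k == l) - gen b l s *+ (k == l.+1)).
Proof.
rewrite op_basis lin_ext_bracket cartan_vec lin_extZ (op_basis (gen b l)).
rewrite gen_vecT lin_ext_sum scaler_sumr -sumrB -!sumrMnl -sumrB scaler_sumr.
apply: eq_bigr => v /eqP vl; rewrite lin_extZ cartan_vec.
apply: lin_comb_weight.
by have := hval_step k b v (val s); rewrite vl.
Qed.

Lemma cartan_cartan k l : end_bracket (cartan k) (cartan l) = 0.
Proof.
apply/funext => s; rewrite op_basis lin_ext_bracket (cartan_vec k) (cartan_vec l).
by rewrite !lin_extZ (cartan_vec k) (cartan_vec l) !scalerA mulrC subrr.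
Qed.

Lemma gen_far b k l : (k.+1 < l)%N -> (l.+1 < n)%N -> end_bracket (gen b k) (gen b l) = 0.
Proof.
move=> kl ln; apply/funext => s; rewrite op_basis lin_ext_bracket.
apply/eqP; rewrite subr_eq0; apply/eqP; apply: op_commute => //.
- exact: basis_good.
- lia.
move=> v w vl wk; apply: coef_comm_far.
- by apply/eqP => e; move: vl; rewrite e; lia.
- by rewrite /ref_row vl wk; case: (b); lia.
- by rewrite /ref_row vl wk; case: (b); lia.
Qed.

Lemma gen_opp k l : (k.+1 < n)%N -> (l.+1 < n)%N ->
  end_bracket (gen true k) (gen false l) = (cartan k - cartan k.+1) *+ (k == l).
Proof.
move=> kn ln; apply/funext => s; rewrite op_basis lin_ext_bracket.
have gS := basis_good s; have [ekl|nkl] := eqVneq k l; last first.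
  rewrite mulr0n; apply/eqP; rewrite subr_eq0; apply/eqP; apply: op_commute => //.
  move=> v w vl wk; apply: (@coef_comm_opp _ _ false).
  by apply: contra_neq nkl => e; rewrite -vl -wk e.
subst l; rewrite mulr1n !word2 [X in _ - X]exchange_big -sumrB.
(* Opposite moves at different vertices commute, so only the moves that raise and lower the same
   entry remain. *)
transitivity (\sum_(v | vrow v == k :> nat)
    (mono [:: (false, v); (true, v)] (val s) - mono [:: (true, v); (false, v)] (val s))).
  apply: eq_bigr => v vk; rewrite -sumrB (bigD1 v) //= big1 ?addr0 // => w.
  case/andP => wk wv; apply/eqP; rewrite subr_eq0; apply/eqP.
  apply: mono_comm => //; [exact: row_not_top vk|exact: row_not_top wk|].
  by apply: (@coef_comm_opp _ _ false); rewrite eq_sym.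
have back b v : step (~~ b) v (step b v (val s)) = val s.
  rewrite /step add_deltaD (_ : sg C b + sg C (~~ b) = 0) ?add_delta0 //.
  by case: b; rewrite /sg /= ?subrr ?addNr.
transitivity ((hval k (val s) - hval k.+1 (val s)) *: << s >> : VG G L); last first.
  by rewrite scalerBl -!cartanE.
rewrite -(diag_scalar sepG gS kn) scaler_suml; apply: eq_bigr => v vk.
have tv := row_not_top kn vk.
rewrite !(monoE adjG) //; [|by rewrite /movable /= tv..].
have -> : target [:: (false, v); (true, v)] (val s) = val s by exact: (back false).
have -> : target [:: (true, v); (false, v)] (val s) = val s by exact: (back true).
by rewrite gS vecT_val -scalerBl.
Qed.

(** The relation [p + q = 2 r] between the three words, in each nesting of brackets required by
    [half_serre] for the bracket and for its reverse. *)
Lemma gen_serre b k l s : (k.+1 < n)%N -> (l.+1 < n)%N -> (l == k.+1) || (k == l.+1) ->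
  [/\ end_bracket (end_bracket (gen b k) (gen b l)) (gen b k) s = 0,
      end_bracket (end_bracket (gen b l) (gen b k)) (gen b k) s = 0,
      end_bracket (gen b k) (end_bracket (gen b l) (gen b k)) s = 0
    & end_bracket (gen b k) (end_bracket (gen b k) (gen b l)) s = 0].
Proof.
move=> kn ln kl; have := op_serre b (basis_good s) kn ln kl.
rewrite ![end_bracket _ _ s]op_basis !lin_ext_bracket !lin_ext_sub.
set p := op b k (op b k (op b l _)); set q := op b l (op b k (op b k _)).
set r := op b k (op b l (op b k _)) => e.
have e1 : p - r = r - q by apply/eqP; rewrite subr_eq addrAC eq_sym subr_eq -mulr2n -e.
have e2 : r - p = q - r by rewrite -[LHS]opprB e1 opprB.
by split; [rewrite e1|rewrite e2|rewrite e2|rewrite e1]; rewrite subrr.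
Qed.

Theorem tableau_serre_relations :
  serre_relations n (@end_bracket C (basisVG G L)) (gen true) (gen false) cartan.
Proof.
have zero (g : basisVG G L -> VG G L) : (forall s, g s = 0) -> g = 0.
  by move=> h; apply/funext => s; rewrite h.
split; first split.
- move=> k l kn ln; apply/funext => s; rewrite cartan_gen /sg scale1r.
  by case: (k == l); case: (k == l.+1).
- by move=> k l kl ln; apply: gen_far.
- move=> k kn; apply: zero => s.
  by have [] := @gen_serre true k k.+1 s (ltnW kn) kn; rewrite ?eqxx.
- move=> k kn; apply: zero => s.
  by have [] := @gen_serre true k.+1 k s kn (ltnW kn); rewrite ?eqxx ?orbT.
- split; rewrite /flip_bracket.
  + move=> k l kn ln; have [_ A _] := @end_bracket_lie C (basisVG G L).
    apply/funext => s; rewrite A opprfctE cartan_gen /sg scaleN1r opprK.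
    by case: (k == l); case: (k == l.+1).
  + move=> k l kl ln; have [_ A _] := @end_bracket_lie C (basisVG G L).
    by rewrite A gen_far // oppr0.
  + move=> k kn; apply: zero => s.
    by have [] := @gen_serre false k k.+1 s (ltnW kn) kn; rewrite ?eqxx.
  + move=> k kn; apply: zero => s.
    by have [] := @gen_serre false k.+1 k s kn (ltnW kn); rewrite ?eqxx ?orbT.
- exact: gen_opp.
- by move=> k l _ _; apply: cartan_cartan.
Qed.

Theorem separated_GT_module : GT_module G L.
Proof.
have [rho [mod_rho rho_e rho_f rho_h]] := gl_module_of_serre tableau_serre_relations.
exists rho; split=> //.
- move=> k l s kl; rewrite (rho_e _ _ _ kl) genE /GT_raise -sumrN.
  apply: eq_big => [v|v /eqP vk]; first by rewrite -val_eqE.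
  have -> : coef true v (val s) =
      - ((\prod_(w | vrow w == k.+1 :> nat) (val s v - val s w)) / denom (val s) v).
    rewrite /coef /sg mulN1r mulNr; congr (- (_ / _)).
    by apply: eq_bigl => t; rewrite /ref_row vk.
  by rewrite scaleNr.
- move=> k l s kl; rewrite (rho_f _ _ _ kl) genE /GT_lower.
  apply: eq_big => [v|v /eqP vk]; first by rewrite -val_eqE.
  have -> // : coef false v (val s) =
      (\prod_(w | (vrow w).+1 == k :> nat) (val s v - val s w)) / denom (val s) v.
  rewrite /coef /sg opprK mul1r; congr (_ / _).
  by apply: eq_bigl => t; rewrite /ref_row vk.
- move=> k s; rewrite rho_h cartanE /GT_diag vecT_val.
  have -> // : hval k (val s) =
    (k : nat)%:R + \sum_(v | vrow v == k) val s v -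
      \sum_(v | (vrow v).+1 == k :> nat) val s v.
  by rewrite /hval; congr (_ + _ - _); apply: eq_bigl => v; rewrite -val_eqE.
Qed.

End SerreRelationsOfTableaux.

(** * Graphs of tableaux *)

Section TransitiveReduction.
Variable n : nat.
Implicit Types (P : graph n) (u v w : vertex n).

(** A smallest graph with the right reachability among the subgraphs of [P] is inclusion-minimal,
    hence equal to the reduction by uniqueness. *)
Lemma transitive_reduction_sub P : (forall u v, arrow P u v -> ~~ reach P v u) ->
  forall u v, arrow (transitive_reduction P) u v -> arrow P u v.
Proof.
move=> acP u v; pose good (H : graph n) := (H \subset P) && same_reach P H.
have gP : good P by rewrite /good subxx; apply/same_reachP.
case: (arg_minnP (fun H : graph n => #|H|) gP) => H /andP[HP /same_reachP rH] minH.
have -> : transitive_reduction P = H; last by rewrite /arrow => /(subsetP HP).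
apply/esym/transitive_reduction_uniq => // H' H'H rH'; apply/eqP.
rewrite eqEcard H'H /=; apply: minH; rewrite /good (subset_trans H'H HP).
exact/same_reachP.
Qed.

(** A path from [u] to [v] in the reduction has no admissible intermediate vertex, so it contains
    the single arrow. *)
Lemma transitive_reduction_cover P u v : u != v -> reach P u v ->
  (forall w, reach P u w -> reach P w v -> w = u \/ w = v) ->
  arrow (transitive_reduction P) u v.
Proof.
move=> uv + cov; have [eR _] := transitive_reductionP P; rewrite -eR.
case/connectP=> p; elim: p => [|w p IH] /=; first by move=> _ e; rewrite e eqxx in uv.
case/andP=> uw pth e; have wv : reach P w v by rewrite -eR; apply/connectP; exists p.
have uw' : reach P u w by rewrite -eR; apply: connect1.
case: (cov w uw' wv) => ew; last by rewrite -ew.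
by rewrite ew in pth e; apply: IH.
Qed.

End TransitiveReduction.

Section RelationGraphs.
Variables (C : numFieldType) (n : nat).
Implicit Types (T S : tableau C n) (u v w : vertex n).

Lemma pre_graph_adj T : adjacent_arrows (pre_graph T).
Proof.
move=> u v; rewrite /arrow inE /=.
case/or3P=> [/andP[/eqP e _]|/andP[/eqP e _]|/and5P[tu tv _ _ _]].
- exact: Or31.
- exact: Or32.
- exact: Or33.
Qed.

Lemma graph_of_sub T u v : arrow (graph_of T) u v -> arrow (pre_graph T) u v.
Proof. exact/transitive_reduction_sub/pre_graph_acyclic. Qed.

Lemma graph_of_reach T : reach (graph_of T) =2 reach (pre_graph T).
Proof. by case: (transitive_reductionP (pre_graph T)). Qed.

Lemma graph_of_adj T : adjacent_arrows (graph_of T).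
Proof. by move=> u v /graph_of_sub/pre_graph_adj. Qed.

Lemma separated_relation_graph T :
  noncritical (graph_of T) -> separated C (graph_of T) ->
  relation_graph C (graph_of T).
Proof.
move=> nc sep; split=> //; last first.
  by move=> L _; apply: separated_GT_module => //; apply: graph_of_adj.
split; first exact: graph_of_adj.
by move=> u v /graph_of_sub/pre_graph_acyclic; rewrite graph_of_reach.
Qed.

End RelationGraphs.

(** * Generic weights *)

Section IsInt.
Variable C : numFieldType.
Implicit Types x y : C.

Lemma is_intD x y : is_int x -> is_int y -> is_int (x + y).
Proof. by case=> a -> [b ->]; exists (a + b); rewrite rmorphD. Qed.

Lemma is_intN x : is_int x -> is_int (- x).
Proof. by case=> a ->; exists (- a); rewrite rmorphN. Qed.

Lemma is_int_nat (m : nat) : is_int (m%:R : C).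
Proof. by exists m%:Z; rewrite -pmulrn. Qed.

End IsInt.

Section GenericWeights.
Variables (C : numFieldType) (n : nat) (s : 'S_n) (lam : 'I_n -> C).
Implicit Types (u v w : vertex n).
Hypothesis generic : forall i j : 'I_n, (i < j)%N -> ~ is_int (lam i - lam j).

Local Notation T := (Tsigma s (shifted_weight lam)).

Lemma Tsigma_col v : is_int (T v - lam ((s^-1)%g (vcol v))).
Proof.
rewrite ffunE; elim: (_ - _)%N => [|d IH] /=.
  by rewrite /shifted_weight addrAC subrr add0r; apply/is_intN/is_int_nat.
case: ifP => // _; rewrite addrAC; apply: is_intD => //; exact: (is_int_nat C 1).
Qed.

(** Entries of a column agree with one [lam i] modulo integers, and different [lam i] are
    incongruent. *)
Lemma arrow_col u v : arrow (graph_of T) u v -> vcol u = vcol v.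
Proof.
move/graph_of_sub => uv.
have {uv} : is_int (T u - T v).
  move: uv; rewrite /arrow inE /=.
  case/or3P=> [/andP[_ /asboolP[m ->]]|/andP[_ /asboolP[m ->]]|].
  - exact: is_int_nat.
  - exact: is_int_nat.
  - by case/and5P=> _ _ _ /asboolP[m ->] _; apply: is_int_nat.
set i := ((s^-1)%g (vcol u)); set j := ((s^-1)%g (vcol v)) => h.
have {}h : is_int (lam i - lam j).
  have -> : lam i - lam j = - (T u - lam i) + (T u - T v) + (T v - lam j) by ring.
  by apply: is_intD (Tsigma_col v); apply: is_intD h; apply/is_intN/Tsigma_col.
have [ij|ji|e] := ltngtP i j.
- by case: (generic ij).
- by case: (generic ji); rewrite -opprB; apply: is_intN.
- by apply: (@perm_inj _ (s^-1)%g); apply: val_inj.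
Qed.

Lemma component_col u v : same_component (graph_of T) u v -> vcol u = vcol v.
Proof.
case/connectP=> p; elim: p u => [|w p IH] u /=; first by move=> _ ->.
by case/andP=> /orP[] /arrow_col e /IH h /h <-.
Qed.

Lemma generic_relation_weight : sigma_relation_weight s lam.
Proof.
apply: separated_relation_graph.
  move=> u v uv _ /component_col e; rewrite (vertex_eq uv e).
  by rewrite /reach connect0.
move=> S [_ int] v w vw tv nvw.
(* An integral difference would put [v] and [w] in one component, hence in one column. Both clauses
   of [separated] thus hold vacuously. *)
have notint : ~ is_int (S v - S w).
  move=> h; have /component_col e := int _ _ vw tv h.
  by rewrite (vertex_eq vw e) eqxx in nvw.
split=> e; case: notint; rewrite e.
  by rewrite subrr; apply: (is_int_nat C 0).
by rewrite addrAC subrr add0r; apply: (is_int_nat C 1).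
Qed.

End GenericWeights.

(** * Dominant weights *)

Section DominantWeights.
Variables (C : numFieldType) (n : nat) (s : 'S_n) (lam : 'I_n -> C).
Implicit Types (u v w x y z : vertex n) (i j : 'I_n) (S : tableau C n).
Hypothesis dominant : forall i j : 'I_n, (i < j)%N -> is_nneg (lam i - lam j).

Local Notation T := (Tsigma s (shifted_weight lam)).
Local Notation G := (graph_of T).

(** The index of the component of [lam] that heads the column of [v]. *)
Definition idx v : 'I_n := (s^-1)%g (vcol v).
Definition below (k : nat) (j : 'I_n) : {set 'I_n} :=
  [set c : 'I_n | (c <= k)%N && ((s^-1)%g c < j)%N].
(* The position of [v] when its row is sorted by decreasing entries. *)
Definition rank v : nat := #|below (vrow v) (idx v)|.

Lemma below_lt k v j : (vcol v <= k)%N -> (idx v < j)%N ->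
  (#|below k (idx v)| < #|below k j|)%N.
Proof.
move=> ck ij; apply: proper_card; apply/properP; split.
  by apply/subsetP => c; rewrite !inE => /andP[-> /= h]; apply: ltn_trans ij.
by exists (vcol v); rewrite !inE ck ?ltnn.
Qed.

Lemma below_rowS (k : nat) (r : 'I_n) j : r = k.+1 :> nat ->
  #|below k.+1 j| = (((s^-1)%g r < j)%N + #|below k j|)%N.
Proof.
move=> rk; rewrite (cardsD1 r) inE rk leqnn /=; congr (_ + _)%N.
apply: eq_card => c; rewrite !inE -val_eqE /= rk andbA; congr (_ && _).
by rewrite -ltn_neqAle ltnS.
Qed.

Lemma vcol_le v : (vcol v <= vrow v)%N.
Proof. exact: (valP v). Qed.

Lemma card_ord_lt (k : nat) : (k <= n)%N -> #|[set c : 'I_n | (c < k)%N]| = k.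
Proof.
move=> kn; have inj : injective (widen_ord kn).
  by move=> a b /(congr1 val) /= e; apply: val_inj.
rewrite -[RHS]card_ord -(card_imset _ inj).
apply: eq_card => c; rewrite !inE; apply/idP/imsetP => [ck|[i _ ->] /=].
  by exists (Ordinal ck) => //; apply: val_inj.
exact: (valP i).
Qed.

Lemma rank_le v : (rank v <= vrow v)%N.
Proof.
have sub : below (vrow v) (idx v) \subset [set c : 'I_n | (c <= vrow v)%N] :\ vcol v.
  apply/subsetP => c; rewrite !inE => /andP[-> h]; rewrite andbT.
  by apply: contraTneq h => ->; rewrite ltnn.
rewrite -ltnS; apply: leq_ltn_trans (subset_leq_card sub) _.
have := cardsD1 (vcol v) [set c : 'I_n | (c <= vrow v)%N].
rewrite inE vcol_le add1n => <-.
by rewrite (@card_ord_lt (vrow v).+1 (ltn_ord _)).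
Qed.

Lemma rank_lt_idx v w : vrow v = vrow w -> (idx v < idx w)%N -> (rank v < rank w)%N.
Proof. by rewrite /rank => <-; apply: below_lt; apply: vcol_le. Qed.

Lemma rank_inj v w : vrow v = vrow w -> rank v = rank w -> v = w.
Proof.
move=> vw e; have [h|h|h] := ltngtP (idx v) (idx w).
- by have := rank_lt_idx vw h; rewrite e ltnn.
- by have := rank_lt_idx (esym vw) h; rewrite e ltnn.
- by apply: vertex_eq => //; apply: (@perm_inj _ (s^-1)%g); apply: val_inj.
Qed.

(** The upper row has exactly one more column, so passing to it raises a rank by at most one; strict
    monotonicity in the index then excludes the opposite order. *)
Lemma rank_above_idx u v : vrow u = (vrow v).+1 :> nat ->
  ((rank u <= rank v)%N -> (idx u <= idx v)%N) /\
  ((rank v < rank u)%N -> (idx v <= idx u)%N).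
Proof.
move=> uv; have rS j := below_rowS j uv.
split=> h; rewrite leqNgt; apply/negP => lt; move: h; rewrite /rank ?uv.
  have := @below_lt (vrow v).+1 v (idx u) _ lt; rewrite !rS => /(_ _).
  by have := vcol_le v; lia.
have := @below_lt (vrow v).+1 u (idx v) _ lt; rewrite !rS.
by have := vcol_le u; rewrite uv; lia.
Qed.

Lemma dominant_le i j : (i <= j)%N -> is_nneg (lam i - lam j).
Proof.
rewrite leq_eqVlt => /orP[/eqP/val_inj ->|]; last exact: dominant.
by exists 0%N; rewrite subrr.
Qed.

(** In the top row all columns are present and the rank is the index itself. One row down, one
    column disappears; its index is smaller than [idx v] exactly when [Gsigma s] has the upward
    arrow, that is, when [Tsigma] adds [1]. *)
Lemma Tsigma_rank v : T v = lam (idx v) - (rank v)%:R.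
Proof.
have [d] := ubnP (n - vrow v)%N; elim: d v => // d IH v; rewrite ltnS => hd.
have [tv|ntv] := boolP (vtop v).
  rewrite Tsigma_top // /shifted_weight; congr (_ - _%:R).
  rewrite /rank -[LHS](@card_ord_lt (idx v) (ltnW (ltn_ord _))).
  rewrite -[LHS](card_imset _ (@perm_inj _ s)); apply: eq_card => c; rewrite !inE.
  apply/imsetP/andP => [[i + ->]|[_ h]].
    rewrite inE permK => h; split=> //.
    by rewrite -ltnS (eqP tv); apply: ltn_ord.
  by exists ((s^-1)%g c); rewrite ?inE ?permKV.
have rn : ((vrow v).+1 < n)%N by have := ltn_ord (vrow v); move: ntv; rewrite /vtop; lia.
have hu : ((Ordinal rn, vcol v).2 <= (Ordinal rn, vcol v).1)%N.
  by rewrite /= leqW // vcol_le.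
pose u : vertex n := exist _ (Ordinal rn, vcol v) hu.
have uv : above u v by rewrite /above /= !eqxx.
have idu : idx u = idx v by [].
rewrite (Tsigma_rec _ _ uv) IH; last by rewrite /=; lia.
have /andP[SG /eqP QE] := GsigmaP s.
have [_ <-] := mem_QG SG uv; rewrite QE mem_act_roots -/(idx u) idu.
have -> : rank u = (((s^-1)%g (vrow u) < idx v)%N + rank v)%N.
  by rewrite /rank idu -below_rowS.
by rewrite natrD; case: (_ < idx v)%N; rewrite /= ?add0r //; ring.
Qed.

(** Ranks in row [r] are distinct and at most [r], so they fill the whole range. *)
Lemma vrow_rank_exists (r k : nat) : (r < n)%N -> (k <= r)%N ->
  exists2 v, vrow v = r :> nat & rank v = k.
Proof.
move=> rn kr.
have cn (c : 'I_r.+1) : (c < n)%N by apply: leq_trans (ltn_ord c) rn.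
have cr (c : 'I_r.+1) :
    ((Ordinal rn, Ordinal (cn c)).2 <= (Ordinal rn, Ordinal (cn c)).1)%N.
  by rewrite /= -ltnS.
pose g (c : 'I_r.+1) : vertex n := exist _ (Ordinal rn, Ordinal (cn c)) (cr c).
have gr c : (rank (g c) < r.+1)%N by rewrite ltnS; apply: (rank_le (g c)).
pose f c : 'I_r.+1 := Ordinal (gr c).
have injf : injective f.
  move=> c c' /(congr1 val) /= /(rank_inj (v := g c) (w := g c')) e.
  by have /(congr1 (fun v => vcol v : nat)) /= := e erefl; apply: ord_inj.
have kr' : (k < r.+1)%N by [].
have /codomP[c /(congr1 val) /= ->] := injF_onto injf (Ordinal kr').
by exists (g c).
Qed.

Lemma neg_nneg (m m' : nat) : - (m%:R : C) = m'%:R -> m = 0%N /\ m' = 0%N.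
Proof.
move/eqP; rewrite eq_sym -subr_eq0 opprK -natrD pnatr_eq0 addn_eq0.
by case/andP=> /eqP -> /eqP ->.
Qed.

(** Arrows never decrease the rank and never increase row minus rank; thus reachability is contained
    in a product order. *)
Lemma pre_graph_rank x y : arrow (pre_graph T) x y ->
  (rank x <= rank y)%N /\ (vrow y + rank x <= vrow x + rank y)%N.
Proof.
(* If the rank drops by [m] while [lam] does not decrease, then [T x - T y <= - m], which is
   nonnegative only for [m = 0] and difference [0]. *)
have key (m m' : nat) : (rank y + m = rank x)%N -> is_nneg (lam (idx y) - lam (idx x)) ->
    T x - T y = m'%:R -> m = 0%N /\ m' = 0%N.
  move=> rk [a ha]; rewrite !Tsigma_rank -rk natrD => e.
  suff /neg_nneg : - ((a + m)%:R : C) = m'%:R by case; lia.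
  by rewrite natrD -ha -e; ring.
rewrite /arrow inE /= => /or3P[/andP[/eqP r /asboolP[m h]]|/andP[/eqP r /asboolP[m h]]|].
- have [_ up] := rank_above_idx r; have [le|lt] := leqP (rank x) (rank y).
    by split=> //; rewrite r; lia.
  have := key _ _ (subnKC (ltnW lt)) (dominant_le (up lt)) h; case; lia.
- have [up _] := rank_above_idx r; have [lt|le] := ltnP (rank x) (rank y).
    by split=> //; rewrite ?r; lia.
  by have [_] := key _ _ (subnKC le) (dominant_le (up le)) h.
- case/and5P=> /eqP tx /eqP ty nxy /asboolP[m h] _.
  have rxy : vrow x = vrow y by apply: ord_inj; lia.
  suff le : (rank x <= rank y)%N by rewrite rxy; split=> //; lia.
  rewrite leqNgt; apply/negP => lt.
  have le : (idx y <= idx x)%N.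
    by rewrite leqNgt; apply/negP => /(rank_lt_idx rxy); lia.
  have := key _ _ (subnKC (ltnW lt)) (dominant_le le) h; case; lia.
Qed.

Lemma reach_rank x y : reach (pre_graph T) x y ->
  (rank x <= rank y)%N /\ (vrow y + rank x <= vrow x + rank y)%N.
Proof.
case/connectP=> p; elim: p x => [|z p IH] x /=; first by move=> _ ->.
case/andP=> /pre_graph_rank[a1 a2] /IH h /h[b1 b2]; split; lia.
Qed.

(** The pair is a covering one in the product order: the rank is fixed and row minus rank changes by
    one, so no third vertex fits between. *)
Lemma arrow_down u w : vrow u = (vrow w).+1 :> nat -> rank u = rank w -> arrow G u w.
Proof.
move=> r e; have [h _] := rank_above_idx r.
have uw : arrow (pre_graph T) u w.
  rewrite /arrow inE /= r eqxx /=; apply/orP; left; apply/asboolP.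
  rewrite !Tsigma_rank e (_ : _ - _ = lam (idx u) - lam (idx w)); last by ring.
  by apply/dominant_le/h; rewrite e.
apply: transitive_reduction_cover.
- by apply/eqP => euw; move: r; rewrite euw; lia.
- exact: connect1.
move=> z /reach_rank[a1 a2] /reach_rank[b1 b2].
have [zu|zu] := eqVneq (vrow z : nat) (vrow u).
  by left; apply: rank_inj; [apply: ord_inj|lia].
by right; apply: rank_inj; [apply: ord_inj; lia|lia].
Qed.

(** The other kind of covering pair: row minus rank is fixed and the rank grows by one. *)
Lemma arrow_up w v : vrow v = (vrow w).+1 :> nat -> rank v = (rank w).+1 -> arrow G w v.
Proof.
move=> r e; have [_ h] := rank_above_idx r.
have wv : arrow (pre_graph T) w v.
  rewrite /arrow inE /= r eqxx /=; apply/or3P; apply: Or32; apply/asboolP.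
  have [|m hm] := dominant_le (h _); first by rewrite e.
  by exists m; rewrite !Tsigma_rank e -natr1 -[in RHS]natr1 -hm; ring.
apply: transitive_reduction_cover.
- by apply/eqP => ewv; move: r; rewrite ewv; lia.
- exact: connect1.
move=> z /reach_rank[a1 a2] /reach_rank[b1 b2].
have [zw|zw] := eqVneq (vrow z : nat) (vrow w).
  by left; apply: rank_inj; [apply: ord_inj|lia].
by right; apply: rank_inj; [apply: ord_inj; lia|lia].
Qed.

Lemma neighbours v w : vrow v = vrow w -> ~~ vtop v -> rank w = (rank v).+1 ->
  exists u t,
    [/\ (vrow u).+1 = vrow v :> nat, vrow t = (vrow v).+1 :> nat,
        arrow G v u /\ arrow G u w & arrow G v t /\ arrow G t w].
Proof.
move=> vw tv e; have vwn : (vrow v : nat) = vrow w by rewrite vw.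
have lw := rank_le w; have vn := ltn_ord (vrow v).
have tn : ((vrow v).+1 < n)%N by move: tv; rewrite /vtop; lia.
have [||u ru ku] := @vrow_rank_exists (vrow v).-1 (rank v); [lia..|].
have [||t rt kt] := @vrow_rank_exists (vrow v).+1 (rank w); [lia..|].
exists u, t; split; [lia|by []|split|split].
- by apply: arrow_down; lia.
- by apply: arrow_up; lia.
- by apply: arrow_up; lia.
- by apply: arrow_down; lia.
Qed.

Lemma row_chain d v w : vrow v = vrow w -> ~~ vtop v -> rank w = (rank v + d.+1)%N ->
  exists x u, [/\ vrow v = vrow x, rank x = (rank v + d)%N, (vrow u).+1 = vrow x :> nat,
    arrow G x u & arrow G u w].
Proof.
move=> vw tv e.
have [||x rx kx] := @vrow_rank_exists (vrow v) (rank v + d); [by []| |].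
  by have := rank_le w; rewrite vw; lia.
have vx : vrow v = vrow x by apply: ord_inj.
have [|||u [_ [ru _ [xu uw] _]]] := @neighbours x w.
- by rewrite -vx.
- by move: tv; rewrite /vtop vx.
- by rewrite e kx addnS.
by exists x, u.
Qed.

Lemma row_reach d v w : vrow v = vrow w -> ~~ vtop v -> rank w = (rank v + d)%N ->
  reach G v w.
Proof.
elim: d w => [|d IH] w vw tv e.
  by rewrite (rank_inj vw) ?e ?addn0 //; apply: connect0.
have [x [u [vx kx _ xu uw]]] := row_chain vw tv e.
apply: connect_trans (IH x vx tv kx) _; apply: connect_trans (connect1 xu) _.
exact: connect1.
Qed.

(** Consecutive ranks are linked by a zigzag through the row below, whose upward half is strict, so
    each of the [d] links costs at least [1]. *)
Lemma row_gap S d v w : realization G S -> vrow v = vrow w -> ~~ vtop v ->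
  rank w = (rank v + d)%N -> exists m : nat, S v - S w = (m + d)%:R.
Proof.
move=> [sat _]; elim: d w => [|d IH] w vw tv e.
  by rewrite (rank_inj vw) ?e ?addn0 //; exists 0%N; rewrite subrr.
have [x [u [vx kx ru xu uw]]] := row_chain vw tv e.
have [m hm] := IH x vx tv kx.
have xw : vrow x = vrow w :> nat by rewrite -vx vw.
have := sat _ _ xu; case: eqP => [|_ [a ha]]; first lia.
have := sat _ _ uw; case: eqP => [_ [b hb]|]; last lia.
exists (m + a + b)%N.
have -> : S v - S w = (S v - S x) + (S x - S u) + (S u - S w) by ring.
by rewrite hm ha hb -!natrD; congr (_%:R); lia.
Qed.

Lemma dominant_relation_weight : sigma_relation_weight s lam.
Proof.
apply: separated_relation_graph.
  move=> u v uv tu _; have tv : ~~ vtop v by move: tu; rewrite /vtop uv.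
  have [le|/ltnW le] := leqP (rank u) (rank v).
    by rewrite (row_reach uv tu (esym (subnKC le))).
  by rewrite (row_reach (esym uv) tv (esym (subnKC le))) orbT.
move=> S rS v w vw tv nvw.
have [lt|lt|e] := ltngtP (rank v) (rank w).
- have [m hm] := row_gap rS vw tv (esym (subnKC (ltnW lt))).
  split=> [e|e].
    by move/eqP: hm; rewrite e subrr eq_sym pnatr_eq0; lia.
  (* A difference of [1] must be at least the rank gap, so the ranks are consecutive. In the
     opposite order below, the difference would have the wrong sign. *)
  apply: neighbours => //; move/eqP: hm; rewrite e addrAC subrr add0r.
  by rewrite -[1]/(1%:R) eqr_nat => /eqP; lia.
- have tw : ~~ vtop w by move: tv; rewrite /vtop vw.
  have [m hm] := row_gap rS (esym vw) tw (esym (subnKC (ltnW lt))).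
  split=> [e|e].
    by move/eqP: hm; rewrite e subrr eq_sym pnatr_eq0; lia.
  have /eqP : - (1%:R : C) = (m + (rank v - rank w))%:R by rewrite -hm e; ring.
  by case/eqP/neg_nneg.
- by rewrite (rank_inj vw e) eqxx in nvw.
Qed.

End DominantWeights.

Theorem proposition5p7 (R : realType) (n : nat) (lam : 'I_n -> R[i]) :
  (2 <= n)%N ->
  ((forall i j : 'I_n, (i < j)%N -> ~ is_int (lam i - lam j)) ->
     forall s : 'S_n, sigma_relation_weight s lam) /\
  ((forall i j : 'I_n, (i < j)%N -> is_nneg (lam i - lam j)) ->
     forall s : 'S_n, sigma_relation_weight s lam).
Proof.
move=> _; split=> h s; first exact: generic_relation_weight.
exact: dominant_relation_weight.
Qed.
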